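(* Suppose $f\in L^{\infty}(0,\infty;L^2(\Omega))$ and $u_0\in H^1(\Omega)$. Let $\nu>0$ and denote $\alpha:=1+\nu\lambda^{-2}\Delta t$. For any $\Delta t>0$, solutions $(u_h^n,P_h^n,w_h^n)$ of the backward Euler velocity-vorticity algorithm (described in the context) satisfy, for every positive integer $n$, $$\|u_h^{n}\|^2+\frac{\nu\Delta t}{2}\sum_{k=0}^{n-1}\left(\frac1\alpha\right)^{n-k}\|\nabla u_h^{k+1}\|^2\le\left(\frac1\alpha\right)^n\|u_h^0\|^2+\frac{2\alpha\lambda^2}{\nu^2}\,\|f\|^2_{L^\infty(0,\infty;V_h^* )},$$ $$\|w_h^{n}\|^2+\frac{\nu\Delta t}{2}\sum_{k=0}^{n-1}\left(\frac1\alpha\right)^{n-k}\|\nabla w_h^{k+1}\|^2\le\left(\frac1\alpha\right)^n\|w_h^0\|^2+\frac{2\alpha\lambda^2}{\nu^2}\,\|f\|^2_{L^\infty(0,\infty;L^2(\Omega))}.$$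
   Context: Setting. $\Omega=(0,2\pi)^2\subset\mathbb{R}^2$ with periodic boundary conditions; all functions (including $f$ and $u_0$) are $2\pi$-periodic in each direction with zero mean. $(\cdot,\cdot)$ and $\|\cdot\|$ are the $L^2(\Omega)$ inner product and norm. $X=H^1_\#(\Omega)^2$, $Q=L^2_\#(\Omega)$, $Y=H^1_\#(\Omega)$, where $\#$ denotes $2\pi$-periodic functions of zero mean ($X$ is vector valued; $Q$, $Y$ scalar valued). Discretization. $\tau_h$ is a regular, conforming triangulation of $\Omega$ compatible with the periodic boundary conditions; $X_h\subset X$, $Q_h\subset Q$, $Y_h\subset Y$ are piecewise polynomial finite element spaces on $\tau_h$, with $(X_h,Q_h)$ inf-sup stable. $V_h=\{v_h\in X_h:(\nabla\cdot v_h,q_h)=0\ \forall q_h\in Q_h\}$; $V_h^*$ is its dual, with norm $\|f\|_{V_h^*}=\sup_{0\neq v_h\in V_h}(f,v_h)/\|\nabla v_h\|$. $\lambda$ is a constant, depending only on $\Omega$, in the Poincaré inequality $\|\phi\|\le\lambda\|\nabla\phi\|$ (for $\phi\in X$ and for $\phi\in Y$). For scalar $w$ and $u=(u_1,u_2)$, $w\times u:=(-u_2w,\,u_1w)^T$. For a vector field $f=(f_1,f_2)$, $\nabla\times f=\partial_1f_2-\partial_2f_1$; for $f\in L^2$, $(\nabla\times f,\chi)$ is understood after integration by parts, i.e. as $\int_\Omega(f_1\partial_2\chi-f_2\partial_1\chi)\,dx$. The trilinear form $b^*:X_h\times Y_h\times Y_h\to\mathbb{R}$ is $b^*(u,w,\chi)=(u\cdot\nabla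 w,\chi)+\frac12((\nabla\cdot u)w,\chi)$. Backward Euler velocity-vorticity algorithm. $\nu>0$ is the viscosity, $\Delta t>0$ the time step, $t^n=n\Delta t$, $f^n=f(t^n)$. Given $f$ and $u_0$, let $u_h^0\in X_h$ be the interpolant of $u_0$ and $w_h^0\in Y_h$ the interpolant of $\nabla\times u_0$. For $n=0,1,2,\dots$: Step 1: find $(u_h^{n+1},P_h^{n+1})\in(X_h,Q_h)$ such that for all $(v_h,q_h)\in(X_h,Q_h)$, $$\tfrac{1}{\Delta t}(u_h^{n+1}-u_h^n,v_h)+(w_h^n\times u_h^{n+1},v_h)-(P_h^{n+1},\nabla\cdot v_h)+\nu(\nabla u_h^{n+1},\nabla v_h)=(f^{n+1},v_h),\qquad(\nabla\cdot u_h^{n+1},q_h)=0.$$ Step 2: find $w_h^{n+1}\in Y_h$ such that for all $\chi_h\in Y_h$, $$\tfrac1{\Delta t}(w_h^{n+1}-w_h^n,\chi_h)+b^*(u_h^{n+1},w_h^{n+1},\chi_h)+\nu(\nabla w_h^{n+1},\nabla\chi_h)=(\nabla\times f^{n+1},\chi_h).$$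
   Formalization: Since f in L^∞ is defined only up to null sets of times, it is additionally assumed that each value f(t^n), n ≥ 1, is a local essential value of f at t^n (near t^n, f is L²-close to f(t^n) on a set of times of positive measure), as for continuous f. *)

(* Defs.v *)
From HB Require Import structures.
From mathcomp Require Import all_boot all_order all_algebra.
From mathcomp Require Import all_classical all_reals all_analysis.
From mathcomp Require Import ess_sup_inf.
Set Implicit Arguments.
Unset Strict Implicit.
Unset Printing Implicit Defensive.
Import Order.TTheory GRing.Theory Num.Theory.
Import numFieldNormedType.Exports.
Local Open Scope classical_set_scope.
Local Open Scope ring_scope.

(* Scalar and vector fields on the plane.  Functions on the torus are
   represented by their 2pi-periodic extensions to R^2. *)
Notation sfield R := (R * R -> R)%type (only parsing).
Notation vfield R := ((R * R -> R) * (R * R -> R))%type (only parsing).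

Section L2.
Context {R : realType}.
Implicit Types (f g : sfield R) (u v : vfield R).

Definition Omega : set (R * R) := `]0, 2 * pi[ `*` `]0, 2 * pi[.

Local Notation leb2 := (@lebesgue_measure R \x @lebesgue_measure R)%E.

Definition integ f : R := \int[leb2]_(x in Omega) f x.

Definition ip f g : R := integ (fun x => f x * g x).
Definition normL2 f : R := Num.sqrt (ip f f).

Definition ipv u v : R := ip u.1 v.1 + ip u.2 v.2.
Definition normL2v u : R := Num.sqrt (ipv u u).

Definition periodic2 f : Prop := forall x,
  f (x.1 + 2 * pi, x.2) = f x /\ f (x.1, x.2 + 2 * pi) = f x.

Definition L2per : set (sfield R) := [set f : sfield R |
  [/\ measurable_fun [set: measurableTypeR R * measurableTypeR R] f,
      leb2.-integrable Omega (fun x => (f x ^+ 2)%:E)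
    & periodic2 f]].

(* the space Q: periodic, square integrable, zero mean *)
Definition L2z : set (sfield R) := [set f | L2per f /\ integ f = 0].
Definition L2zv : set (vfield R) := [set u | L2z u.1 /\ L2z u.2].

End L2.

Section H1.
Context {R : realType}.
Implicit Types (f phi w chi : sfield R) (u v : vfield R).

Definition pd1 f : sfield R := fun x => derive1 (fun s : R => f (s, x.2)) x.1.
Definition pd2 f : sfield R := fun x => derive1 (fun s : R => f (x.1, s)) x.2.

Fixpoint Ck (n : nat) f : Prop :=
  match n with
  | 0 => continuous f
  | m.+1 => [/\ continuous f,
      forall x : R * R, derivable (fun s : R => f (s, x.2)) x.1 1 /\
                        derivable (fun s : R => f (x.1, s)) x.2 1,
      Ck m (pd1 f) & Ck m (pd2 f)]
  end.
Definition smooth f : Prop := forall n, Ck n f.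

(* g is a weak gradient of f on the torus: the test functions are the smooth
   periodic functions, so no boundary term appears. *)
Definition is_wgrad f (g : vfield R) : Prop :=
  [/\ L2per g.1, L2per g.2 &
    forall phi, smooth phi -> periodic2 phi ->
      ip f (pd1 phi) = - ip g.1 phi /\ ip f (pd2 phi) = - ip g.2 phi].

(* the space Y, and the space X of vector fields with components in it *)
Definition H1z : set (sfield R) := [set f | L2z f /\ exists g : vfield R, is_wgrad f g].
Definition H1zv : set (vfield R) := [set u | H1z u.1 /\ H1z u.2].

(* The weak gradient is unique up to a null set; [grad f] is a chosen version,
   and it is only used under integrals. *)
Definition grad f : vfield R := get [set g : vfield R | is_wgrad f g].

Definition normgrad f : R := normL2v (grad f).

Definition ipgrad u v : R :=
  ipv (grad u.1) (grad v.1) + ipv (grad u.2) (grad v.2).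
Definition normgradv u : R := Num.sqrt (ipgrad u u).

Definition div v : sfield R := fun x => (grad v.1).1 x + (grad v.2).2 x.
Definition curl v : sfield R := fun x => (grad v.2).1 x - (grad v.1).2 x.

(* (curl v, chi), integrated by parts, for v merely square integrable *)
Definition ipcurl v chi : R :=
  integ (fun x => v.1 x * (grad chi).2 x - v.2 x * (grad chi).1 x).

Definition cross w u : vfield R :=
  (fun x => - u.2 x * w x, fun x => u.1 x * w x).

Definition bstar u w chi : R :=
  ip (fun x => u.1 x * (grad w).1 x + u.2 x * (grad w).2 x) chi
  + 2^-1 * ip (fun x => div u x * w x) chi.

Definition poincare_constant (lambda : R) : Prop :=
  [/\ 0 < lambda,
      forall phi : vfield R, H1zv phi -> normL2v phi <= lambda * normgradv phi
    & forall phi : sfield R, H1z phi -> normL2 phi <= lambda * normgrad phi].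

End H1.

Section Mesh.
Context {R : realType}.
Implicit Types (tau : seq (3.-tuple (R * R))) (T : 3.-tuple (R * R)).

Definition hull (s : seq (R * R)) : set (R * R) := [set x |
  exists c : 'I_(size s) -> R,
    [/\ forall i, 0 <= c i, \sum_i c i = 1,
        x.1 = \sum_i c i * (s`_i).1 & x.2 = \sum_i c i * (s`_i).2]].

Definition nondegenerate_triangle T : Prop :=
  ((T`_1).1 - (T`_0).1) * ((T`_2).2 - (T`_0).2)
  - ((T`_1).2 - (T`_0).2) * ((T`_2).1 - (T`_0).1) != 0.

(* a and b are vertices of a common triangle: an edge, or a vertex if a = b *)
Definition mesh_edge tau (a b : R * R) : Prop :=
  exists T, [/\ T \in tau, a \in (T : seq _) & b \in (T : seq _)].

(* Conformity: two triangles meet exactly in the convex hull of their common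
   vertices.  Periodicity: opposite sides of the square carry the same
   boundary mesh. *)
Definition triangulation tau : Prop :=
  [/\ forall T, T \in tau -> nondegenerate_triangle T,
      \bigcup_(T in [set` tau]) hull T = `[0, 2 * pi] `*` `[0, 2 * pi],
      forall T T', T \in tau -> T' \in tau ->
        hull T `&` hull T' = hull [seq a <- T | a \in (T' : seq _)],
      forall s t, mesh_edge tau (0, s) (0, t)
                  <-> mesh_edge tau (2 * pi, s) (2 * pi, t)
    & forall s t, mesh_edge tau (s, 0) (t, 0)
                  <-> mesh_edge tau (s, 2 * pi) (t, 2 * pi)].

(* on the interior of each triangle, f is a polynomial of degree at most d in
   each variable; nothing is said about the values on the edges *)
Definition pw_poly tau (d : nat) (f : sfield R) : Prop :=
  forall T, T \in tau -> exists p : {poly {poly R}},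
    [/\ (size p <= d.+1)%N, forall i, (size (p`_i)%R <= d.+1)%N
      & forall x, (hull T)° x -> f x = p.[x.1%:P].[x.2]].

Definition linear_subspace (S : set (sfield R)) : Prop :=
  submod_closed (mem (S : set (R * R -> R^o))).
Definition linear_subspacev (S : set (vfield R)) : Prop :=
  submod_closed (mem (S : set ((R * R -> R^o) * (R * R -> R^o)))).

(* V_h: discretely divergence-free fields *)
Definition Vh (Xh : set (vfield R)) (Qh : set (sfield R)) : set (vfield R) :=
  [set v | Xh v /\ forall q, Qh q -> ip (div v) q = 0].

(* Real [sup] of a set bounded above by Cauchy-Schwarz; it is 0 if Xh = {0}. *)
Definition inf_sup_stable (Xh : set (vfield R)) (Qh : set (sfield R)) : Prop :=
  exists2 beta : R, 0 < beta & forall q, Qh q ->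
    beta * normL2 q <=
    sup [set ip q (div v) / normgradv v | v in [set v | Xh v /\ v <> 0]].

(* A piecewise polynomial field lies in H^1 iff it has a continuous
   representative; in Xh and Yh the continuous one is meant.  The existence of
   a common degree bound makes the spaces finite-dimensional. *)
Record fe_spaces tau (Xh : set (vfield R)) (Qh Yh : set (sfield R)) : Prop :=
  FeSpaces {
    fe_subspaces : [/\ linear_subspacev Xh, linear_subspace Qh & linear_subspace Yh];
    fe_conforming : [/\ Xh `<=` H1zv, Qh `<=` L2z & Yh `<=` H1z];
    fe_pw_poly : exists d,
      [/\ forall v, Xh v -> pw_poly tau d v.1 /\ pw_poly tau d v.2,
          forall q, Qh q -> pw_poly tau d q
        & forall w, Yh w -> pw_poly tau d w];
    fe_continuousX : forall v, Xh v -> continuous v.1 /\ continuous v.2;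
    fe_continuousY : forall w, Yh w -> continuous w;
    fe_inf_sup : inf_sup_stable Xh Qh
  }.

End Mesh.

Section Time.
Context {R : realType}.
Implicit Types (f : R -> vfield R) (g : R -> R).

Definition halfline : set (measurableTypeR R) := `]0, +oo[.
Lemma measurable_halfline : measurable halfline.
Proof. exact: measurable_itv. Qed.

Definition norm_Linfty g : \bar R :=
  ess_sup (mrestr (@lebesgue_measure R) measurable_halfline) (EFin \o g).

Definition simple_field f : Prop :=
  exists m (A : 'I_m -> set (measurableTypeR R)) (v : 'I_m -> vfield R),
    [/\ forall i, measurable (A i), forall i, L2zv (v i)
      & f = fun t => \sum_(i < m) if t \in A i then v i else 0].

Definition strongly_measurable f : Prop :=
  exists s : nat -> R -> vfield R, (forall k, simple_field (s k)) /\
    {ae @lebesgue_measure R, forall t, 0 < t ->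
      (fun k => normL2v (s k t - f t)) @ \oo --> (0 : R)}.

(* f is in L^infty(0, oo; L^2), with values periodic of zero mean *)
Definition Linfty_L2 f : Prop :=
  [/\ forall t, 0 < t -> L2zv (f t), strongly_measurable f
    & (norm_Linfty (fun t => normL2v (f t)) < +oo)%E].

(* An element of L^infty is a class modulo null sets of times, so [f t] is
   arbitrary unless it is tied to the class.  This asks that [f t] be in the
   local essential range of f at t: near t, f is L^2-close to [f t] on a set
   of positive measure.  It holds wherever f is continuous, or one-sided
   continuous, and at every Lebesgue point of f. *)
Definition essential_value f (t : R) : Prop := forall e : R, 0 < e ->
  ~ (@lebesgue_measure R).-negligible
      [set s : R | [/\ 0 < s, `|s - t| < e & normL2v (f s - f t) < e]].

(* Real [sup], bounded for v in L^2 by Poincare; it is 0 if V_h = {0}. *)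
Definition dual_norm (Xh : set (vfield R)) (Qh : set (sfield R))
    (F : vfield R) : R :=
  sup [set ipv F v / normgradv v | v in [set v | Vh Xh Qh v /\ v <> 0]].

End Time.

Section Algorithm.
Context {R : realType}.

(* IX and IY are the interpolation operators; p 0 plays no role. *)
Record be_vv_solution (Xh : set (vfield R)) (Qh Yh : set (sfield R))
    (IX : vfield R -> vfield R) (IY : sfield R -> sfield R)
    (nu dt : R) (f : R -> vfield R) (u0 : vfield R)
    (u : nat -> vfield R) (p w : nat -> sfield R) : Prop := BeVvSolution {
  be_init_u : u 0%N = IX u0;
  be_init_w : w 0%N = IY (curl u0);
  be_mem : forall n, [/\ Xh (u n.+1), Qh (p n.+1) & Yh (w n.+1)];
  be_momentum : forall n v, Xh v ->
    dt^-1 * ipv (u n.+1 - u n) v + ipv (cross (w n) (u n.+1)) v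
    - ip (p n.+1) (div v) + nu * ipgrad (u n.+1) v
    = ipv (f (n.+1%:R * dt)) v;
  be_continuity : forall n q, Qh q -> ip (div (u n.+1)) q = 0;
  be_vorticity : forall n chi, Yh chi ->
    dt^-1 * ip (w n.+1 - w n) chi + bstar (u n.+1) (w n.+1) chi
    + nu * ipv (grad (w n.+1)) (grad chi)
    = ipcurl (f (n.+1%:R * dt)) chi
}.

End Algorithm.

(* Main.v *)
Require Import Defs.
From mathcomp Require Import all_boot all_order all_algebra.
From mathcomp Require Import all_classical all_reals all_analysis.
From mathcomp Require Import measurable_realfun ring lra.
Set Implicit Arguments.
Unset Strict Implicit.
Unset Printing Implicit Defensive.
Import Order.TTheory GRing.Theory Num.Theory.
Import numFieldNormedType.Exports.
Local Open Scope classical_set_scope.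
Local Open Scope ring_scope.

(** Why the theorem is true.  Both estimates come from testing the scheme with
    its own new iterate.  In the momentum equation the rotational term
    disappears pointwise, because [w x u] is orthogonal to [u], and the pressure
    disappears because [u] is discretely divergence free.  In the vorticity
    equation the transport term disappears because [bstar u w w = 0].  What is
    left is, in both cases,
      [(E' - E) / 2 <= dt * (F G' - nu G'^2)],
    with [E], [E'] the old and new squared norms, [G'] the norm of the new
    gradient and [F] the size of the forcing.  Half a unit of [nu dt G'^2]
    absorbs the forcing by Young's inequality, one unit turns [E'] into
    [alpha E'] by Poincare's inequality, and half a unit remains for the sum in
    the statement ([energy_step]).  A geometric iteration ([discrete_gronwall])
    then gives the bound, since [sum_(j >= 1) alpha^-j = lambda^2 / (nu dt)].

    The step with analytic content is [bstar u w w = 0] ([bstar_skew]).  It says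
    that [int d(u w^2) = 0] for continuous periodic [u], [w] with square
    integrable weak derivatives, whereas weak derivatives are defined by testing
    with smooth functions only.  Continuous test functions are reached by
    convolution with the kernel [k(x1 - y1) k(x2 - y2)], where
    [k(t) = c_n ((1 + cos t) / 2)^n].  Being a trigonometric polynomial, the
    kernel is a finite sum of products [A(x) B(y)]; hence regularized functions
    are trigonometric polynomials, and exchanging the two integrations costs
    nothing but linearity ([wderiv_regularized]).  That regularization converges
    uniformly is Korovkin's argument: [|a y - a x|] is bounded by a small
    constant plus a multiple of the function
    [(1 - cos(x1 - y1)) / 2 + (1 - cos(x2 - y2)) / 2], whose kernel average is
    exactly [1 / (n + 1)] ([vp_kernel_approx]).  Passing to the limit gives
    integration by parts between two weakly differentiable continuous functions
    ([wderiv_parts]), hence the product rule and the cancellation.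

    Finally the forcing enters through its value at a time step, while the
    statement has an essential supremum over time.  The two are compared by
    [essential_value_le]: a functional that is Lipschitz for the [L^2] norm takes
    at an essential value of [f] at most the essential supremum of its values
    along [f].  The [L^2] norm and the dual norm are both of this kind. *)

(** * Integration over the periodic cell *)

Section integ_theory.
Context {R : realType}.
Implicit Types (f g h : sfield R).

Local Notation leb2 := (@lebesgue_measure R \x @lebesgue_measure R)%E.
Local Notation Om := (@Omega R : set (measurableTypeR R * measurableTypeR R)).

Lemma measurable_Omega : measurable Om.
Proof. by apply: measurableX; exact: measurable_itv. Qed.

Lemma leb2_Omega : leb2 Om = ((2 * pi) * (2 * pi))%:E.
Proof.
rewrite /Omega product_measure1E; [|exact: measurable_itv..].
by rewrite /= !lebesgue_measure_itv/= lte_fin mulr_gt0 ?pi_gt0// oppr0 addr0.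
Qed.

Lemma Omega_finite : (leb2 Om < +oo)%E.
Proof. by rewrite leb2_Omega ltry. Qed.

Definition L1 f : Prop := leb2.-integrable Om (EFin \o f).
Definition bounded_meas f : Prop :=
  measurable_fun [set: measurableTypeR R * measurableTypeR R] f /\
  exists M : R, forall x, Omega x -> `|f x| <= M.

Lemma bounded_measP f : bounded_meas f ->
  measurable_fun Om f /\ [bounded f x | x in Om].
Proof.
move=> [mf [M fM]]; split; first exact: measurable_funTS.
exists M; split; first exact: num_real.
by move=> N MN x Ox; apply: le_trans (ltW MN); exact: fM.
Qed.

Lemma bounded_meas_L1 f : bounded_meas f -> L1 f.
Proof.
move=> /bounded_measP[mf bf]; apply: measurable_bounded_integrable => //.
- exact: measurable_Omega.
- exact: Omega_finite.
Qed.

Lemma L1M f g : bounded_meas f -> L1 g -> L1 (fun x => f x * g x).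
Proof.
move=> /bounded_measP[mf bf] ig.
by have := integrableMr measurable_Omega mf bf ig.
Qed.

Lemma L1Mr f g : L1 f -> bounded_meas g -> L1 (fun x => f x * g x).
Proof.
by move=> fL gB; under eq_fun do rewrite mulrC; exact: L1M.
Qed.

Lemma L1D f g : L1 f -> L1 g -> L1 (fun x => f x + g x).
Proof. by move=> fL gL; have := integrableD measurable_Omega fL gL. Qed.

Lemma L1Z c f : L1 f -> L1 (fun x => c * f x).
Proof. by move=> fL; have := integrableZl measurable_Omega c fL. Qed.

Lemma L1N f : L1 f -> L1 (fun x => - f x).
Proof. by move=> fL; have := integrableN fL. Qed.

Lemma L1B f g : L1 f -> L1 g -> L1 (fun x => f x - g x).
Proof. by move=> fL /L1N; exact: L1D. Qed.

Lemma L1_norm f : L1 f -> L1 (fun x => `|f x|).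
Proof. by move=> fL; have := integrable_norm fL. Qed.

Lemma L1_le f g : measurable_fun Om f -> (forall x, Omega x -> `|f x| <= g x) ->
  L1 g -> L1 f.
Proof.
move=> mf fg gL; apply: le_integrable gL => //.
- exact: measurable_Omega.
- exact/measurable_EFinP.
- move=> x Ox; rewrite lee_fin; exact: le_trans (fg _ Ox) (ler_norm _).
Qed.

Lemma bounded_meas_cst c : bounded_meas (fun=> c).
Proof. by split; [exact: measurable_cst|exists `|c|]. Qed.

Lemma bounded_measM f g : bounded_meas f -> bounded_meas g -> bounded_meas (fun x => f x * g x).
Proof.
move=> [mf [M fM]] [mg [N gN]]; split; first exact: measurable_funM.
exists (M * N) => x Ox; rewrite normrM; apply: ler_pM => //; [exact: fM|exact: gN].
Qed.

Lemma bounded_measD f g : bounded_meas f -> bounded_meas g -> bounded_meas (fun x => f x + g x).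
Proof.
move=> [mf [M fM]] [mg [N gN]]; split; first exact: measurable_funD.
exists (M + N) => x Ox; rewrite (le_trans (ler_normD _ _))// lerD//; [exact: fM|exact: gN].
Qed.

Lemma integD f g : L1 f -> L1 g -> integ (fun x => f x + g x) = integ f + integ g.
Proof. by move=> *; apply: RintegralD => //; exact: measurable_Omega. Qed.

Lemma integB f g : L1 f -> L1 g -> integ (fun x => f x - g x) = integ f - integ g.
Proof. by move=> *; apply: RintegralB => //; exact: measurable_Omega. Qed.

Lemma integZ c f : L1 f -> integ (fun x => c * f x) = c * integ f.
Proof. by move=> *; apply: RintegralZl => //; exact: measurable_Omega. Qed.

Lemma integN f : L1 f -> integ (fun x => - f x) = - integ f.
Proof. by move=> fL; rewrite -mulN1r -integZ//; congr integ; apply/funext => x; rewrite mulN1r. Qed.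

Lemma le_integ f g : L1 f -> L1 g -> (forall x, Omega x -> f x <= g x) ->
  integ f <= integ g.
Proof. by move=> *; apply: le_Rintegral => //; exact: measurable_Omega. Qed.

Lemma integ_ge0 f : (forall x, Omega x -> 0 <= f x) -> 0 <= integ f.
Proof. by move=> f0; rewrite /integ; exact: Rintegral_ge0. Qed.

Lemma integ0 : integ (fun=> 0 : R) = 0.
Proof.
have := integZ 0 (bounded_meas_L1 (bounded_meas_cst 0)).
by under eq_fun do rewrite mul0r; rewrite mul0r.
Qed.

Lemma le_norm_integ f : L1 f -> `|integ f| <= integ (fun x => `|f x|).
Proof. by move=> *; apply: le_normr_Rintegral => //; exact: measurable_Omega. Qed.

Lemma L1_sum (I : Type) (s : seq I) (F : I -> sfield R) :
  (forall i, L1 (F i)) -> L1 (fun x => \sum_(i <- s) F i x).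
Proof.
move=> FL; elim: s => [|i s IHs].
  by under eq_fun do rewrite big_nil; exact/bounded_meas_L1/bounded_meas_cst.
by under eq_fun do rewrite big_cons; exact: L1D.
Qed.

Lemma integ_sum (I : Type) (s : seq I) (F : I -> sfield R) :
  (forall i, L1 (F i)) ->
  integ (fun x => \sum_(i <- s) F i x) = \sum_(i <- s) integ (F i).
Proof.
move=> FL; elim: s => [|i s IHs].
  by rewrite big_nil; under eq_fun do rewrite big_nil; exact: integ0.
rewrite big_cons -IHs -integD//; last exact: L1_sum.
by congr integ; apply/funext => x; rewrite big_cons.
Qed.

Definition L2 f : Prop :=
  measurable_fun [set: measurableTypeR R * measurableTypeR R] f /\
  L1 (fun x => f x ^+ 2).

Lemma L2perL2 f : L2per f -> L2 f.
Proof. by case. Qed.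

Lemma L2M f g : L2 f -> L2 g -> L1 (fun x => f x * g x).
Proof.
move=> [mf fL] [mg gL].
apply: (@L1_le _ (fun x => f x ^+ 2 + g x ^+ 2)); last exact: L1D.
- by apply: measurable_funTS; exact: measurable_funM.
- move=> x _ /=; rewrite ler_norml.
  by move: (f x) (g x) => a b; apply/andP; split; nra.
Qed.

Lemma L2D f g : L2 f -> L2 g -> L2 (fun x => f x + g x).
Proof.
move=> fL gL; split; first exact: measurable_funD fL.1 gL.1.
under eq_fun do rewrite sqrrD.
apply: L1D gL.2; apply: L1D fL.2 _.
under eq_fun do rewrite -mulr_natl.
by apply: L1Z; exact: L2M.
Qed.

Lemma L2Z c f : L2 f -> L2 (fun x => c * f x).
Proof.
move=> fL; split; first by apply: measurable_funM fL.1; exact: measurable_cst.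
by under eq_fun do rewrite exprMn; apply: L1Z fL.2.
Qed.

Lemma L2N f : L2 f -> L2 (fun x => - f x).
Proof. by move=> /(L2Z (-1)); under eq_fun do rewrite mulN1r. Qed.

Lemma L2B f g : L2 f -> L2 g -> L2 (fun x => f x - g x).
Proof. by move=> fL /L2N; exact: L2D. Qed.

Lemma bounded_meas_L2 f : bounded_meas f -> L2 f.
Proof. by move=> fB; split; [exact: fB.1|apply: bounded_meas_L1; exact: bounded_measM]. Qed.

Lemma L2_L1 f : L2 f -> L1 f.
Proof.
move=> fL; rewrite (_ : f = fun x => f x * 1); last by apply/funext => x; rewrite mulr1.
by apply: L2M => //; exact/bounded_meas_L2/bounded_meas_cst.
Qed.

Lemma ipC f g : ip f g = ip g f.
Proof. by rewrite /ip; congr integ; apply/funext => x; rewrite mulrC. Qed.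

End integ_theory.

(** * Trigonometric polynomials and their partial derivatives *)

Section trig.
Context {R : realType}.
Implicit Types (f g h : sfield R).

(** Trigonometric polynomials in two variables.  Unlike general smooth functions
    they are closed under every operation used below by a plain induction, which
    also gives their joint measurability. *)
Inductive trig : sfield R -> Prop :=
| trig_cst c : trig (fun=> c)
| trig_cos1 : trig (fun x => cos x.1)
| trig_sin1 : trig (fun x => sin x.1)
| trig_cos2 : trig (fun x => cos x.2)
| trig_sin2 : trig (fun x => sin x.2)
| trigD f g : trig f -> trig g -> trig (fun x => f x + g x)
| trigM f g : trig f -> trig g -> trig (fun x => f x * g x).

(** One name for both partial derivatives, so that each argument in a single
    direction is made once. *)
Definition pd (i : bool) f : sfield R := if i then pd1 f else pd2 f.

Lemma trigX n f : trig f -> trig (fun x => f x ^+ n).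
Proof.
move=> tf; elim: n => [|n IHn]; first exact: trig_cst.
by under eq_fun do rewrite exprS; exact: trigM.
Qed.

Lemma trig_sum (I : Type) (s : seq I) (F : I -> sfield R) :
  (forall i, trig (F i)) -> trig (fun x => \sum_(i <- s) F i x).
Proof.
move=> FL; elim: s => [|i s IHs].
  by under eq_fun do rewrite big_nil; exact/trig_cst.
by under eq_fun do rewrite big_cons; exact: trigD.
Qed.

Lemma trig_periodic f : trig f -> periodic2 f.
Proof.
have cos2pi (t : R) : cos (t + 2 * pi) = cos t by rewrite mulr_natl cosD2pi.
have sin2pi (t : R) : sin (t + 2 * pi) = sin t by rewrite mulr_natl sinD2pi.
elim=> [c|||||a b _ pa _ pb|a b _ pa _ pb] x; split=> //=;
  by have [pa1 pa2] := pa x; have [pb1 pb2] := pb x; rewrite ?pa1 ?pa2 ?pb1 ?pb2.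
Qed.

Lemma trig_continuous f : trig f -> continuous f.
Proof.
elim=> [c|||||a b _ pa _ pb|a b _ pa _ pb] x.
- exact: cvg_cst.
- by apply: continuous_comp; [exact: cvg_fst|exact: continuous_cos].
- by apply: continuous_comp; [exact: cvg_fst|exact: continuous_sin].
- by apply: continuous_comp; [exact: cvg_snd|exact: continuous_cos].
- by apply: continuous_comp; [exact: cvg_snd|exact: continuous_sin].
- by apply: cvgD; [exact: pa|exact: pb].
- by apply: cvgM; [exact: pa|exact: pb].
Qed.

Lemma trig_bounded_meas f : trig f -> bounded_meas f.
Proof.
have mcos : measurable_fun [set: R] (@cos R).
  by apply: continuous_measurable_fun; exact: continuous_cos.
have msin : measurable_fun [set: R] (@sin R).
  by apply: continuous_measurable_fun; exact: continuous_sin.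
elim=> [c|||||a b _ pa _ pb|a b _ pa _ pb].
- exact: bounded_meas_cst.
- split; first exact: measurableT_comp.
  by exists 1 => x _; rewrite ler_norml cos_geN1 cos_le1.
- split; first exact: measurableT_comp.
  by exists 1 => x _; rewrite ler_norml sin_geN1 sin_le1.
- split; first exact: measurableT_comp.
  by exists 1 => x _; rewrite ler_norml cos_geN1 cos_le1.
- split; first exact: measurableT_comp.
  by exists 1 => x _; rewrite ler_norml sin_geN1 sin_le1.
- exact: bounded_measD.
- exact: bounded_measM.
Qed.

Lemma trig_derive1 f : trig f -> exists2 g, trig g &
  forall x : R * R, is_derive x.1 1 (fun s : R => f (s, x.2)) (g x).
Proof.
elim=> [c|||||a b ta [a' ta' da] tb [b' tb' db]|a b ta [a' ta' da] tb [b' tb' db]].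
- by exists (fun=> 0) => [|x]; [exact: trig_cst|rewrite /=; exact: is_derive_cst].
- exists (fun x => -1 * sin x.1) => [|x]; first exact: trigM (trig_cst _) trig_sin1.
  by rewrite mulN1r; exact: is_derive_cos.
- by exists (fun x => cos x.1) => [|x]; [exact: trig_cos1|exact: is_derive_sin].
- by exists (fun=> 0) => [|x]; [exact: trig_cst|rewrite /=; exact: is_derive_cst].
- by exists (fun=> 0) => [|x]; [exact: trig_cst|rewrite /=; exact: is_derive_cst].
- exists (fun x => a' x + b' x) => [|x]; first exact: trigD.
  exact: is_deriveD.
- exists (fun x => a x * b' x + b x * a' x) => [|x].
    by apply: trigD; exact: trigM.
  by case: x => x1 x2; exact: (is_deriveM (da (x1, x2)) (db (x1, x2))).
Qed.

Lemma trig_derive2 f : trig f -> exists2 g, trig g &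
  forall x : R * R, is_derive x.2 1 (fun s : R => f (x.1, s)) (g x).
Proof.
elim=> [c|||||a b ta [a' ta' da] tb [b' tb' db]|a b ta [a' ta' da] tb [b' tb' db]].
- by exists (fun=> 0) => [|x]; [exact: trig_cst|rewrite /=; exact: is_derive_cst].
- by exists (fun=> 0) => [|x]; [exact: trig_cst|rewrite /=; exact: is_derive_cst].
- by exists (fun=> 0) => [|x]; [exact: trig_cst|rewrite /=; exact: is_derive_cst].
- exists (fun x => -1 * sin x.2) => [|x]; first exact: trigM (trig_cst _) trig_sin2.
  by rewrite mulN1r; exact: is_derive_cos.
- by exists (fun x => cos x.2) => [|x]; [exact: trig_cos2|exact: is_derive_sin].
- exists (fun x => a' x + b' x) => [|x]; first exact: trigD.
  exact: is_deriveD.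
- exists (fun x => a x * b' x + b x * a' x) => [|x].
    by apply: trigD; exact: trigM.
  by case: x => x1 x2; exact: (is_deriveM (da (x1, x2)) (db (x1, x2))).
Qed.

End trig.

Section trig_calculus.
Context {R : realType}.
Implicit Types (f g h : sfield R).

Local Notation leb2 := (@lebesgue_measure R \x @lebesgue_measure R)%E.

Lemma pd1_val f (d : R) (x : R * R) :
  is_derive x.1 1 (fun s : R => f (s, x.2)) d -> pd1 f x = d.
Proof. by move=> ?; rewrite /pd1 derive1E derive_val. Qed.

Lemma pd2_val f (d : R) (x : R * R) :
  is_derive x.2 1 (fun s : R => f (x.1, s)) d -> pd2 f x = d.
Proof. by move=> ?; rewrite /pd2 derive1E derive_val. Qed.

Lemma trig_pd i f : trig f -> trig (pd i f).
Proof.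
case: i => tf /=.
  have [g tg dg] := trig_derive1 tf.
  by rewrite (_ : pd1 f = g)//; apply/funext => x; exact: pd1_val.
have [g tg dg] := trig_derive2 tf.
by rewrite (_ : pd2 f = g)//; apply/funext => x; exact: pd2_val.
Qed.

Lemma trig_smooth f : trig f -> smooth f.
Proof.
move=> tf n; elim: n f tf => [|n IHn] f tf /=; first exact: trig_continuous.
split; [exact: trig_continuous| |exact/IHn/(trig_pd true)|exact/IHn/(trig_pd false)].
move=> x; split.
  by have [g _ /(_ x) []] := trig_derive1 tf.
by have [g _ /(_ x) []] := trig_derive2 tf.
Qed.

Lemma pd_cst i (c : R) : pd i (fun=> c) = fun=> 0.
Proof.
apply/funext => x; case: i => /=; [apply: pd1_val|apply: pd2_val];
  exact: is_derive_cst.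
Qed.

Lemma pdD i f g : trig f -> trig g ->
  pd i (fun x => f x + g x) = fun x => pd i f x + pd i g x.
Proof.
move=> tf tg; apply/funext => x; case: i => /=.
  have [f' _ /(_ x) df] := trig_derive1 tf.
  have [g' _ /(_ x) dg] := trig_derive1 tg.
  by rewrite (pd1_val df) (pd1_val dg); apply: pd1_val; exact: is_deriveD.
have [f' _ /(_ x) df] := trig_derive2 tf.
have [g' _ /(_ x) dg] := trig_derive2 tg.
by rewrite (pd2_val df) (pd2_val dg); apply: pd2_val; exact: is_deriveD.
Qed.

Lemma pdM i f g : trig f -> trig g ->
  pd i (fun x => f x * g x) = fun x => f x * pd i g x + g x * pd i f x.
Proof.
move=> tf tg; apply/funext => -[x1 x2]; case: i => /=.
  have [f' _ /(_ (x1, x2)) df] := trig_derive1 tf.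
  have [g' _ /(_ (x1, x2)) dg] := trig_derive1 tg.
  rewrite (pd1_val df) (pd1_val dg); apply: pd1_val; exact: (is_deriveM df dg).
have [f' _ /(_ (x1, x2)) df] := trig_derive2 tf.
have [g' _ /(_ (x1, x2)) dg] := trig_derive2 tg.
rewrite (pd2_val df) (pd2_val dg); apply: pd2_val; exact: (is_deriveM df dg).
Qed.

Lemma pdZ i c f : trig f -> pd i (fun x => c * f x) = fun x => c * pd i f x.
Proof.
move=> tf; rewrite pdM//; last exact: trig_cst.
by apply/funext => x; rewrite pd_cst mulr0 addr0.
Qed.

Lemma pd_sum i (I : Type) (s : seq I) (F : I -> sfield R) :
  (forall j, trig (F j)) ->
  pd i (fun x => \sum_(j <- s) F j x) = fun x => \sum_(j <- s) pd i (F j) x.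
Proof.
move=> tF; elim: s => [|j s IHs].
  have nil0 (G : I -> sfield R) : (fun x => \sum_(j <- [::]) G j x) = fun=> 0.
    by apply/funext => x; rewrite big_nil.
  by rewrite !nil0 pd_cst.
under eq_fun do rewrite big_cons.
rewrite pdD//; last exact: trig_sum.
by rewrite IHs; apply/funext => x; rewrite big_cons.
Qed.

Lemma pdX i n f : trig f ->
  pd i (fun x => f x ^+ n.+1) = fun x => n.+1%:R * f x ^+ n * pd i f x.
Proof.
move=> tf; elim: n => [|n IHn].
  by under eq_fun do rewrite expr1; apply/funext => x; rewrite expr0 mulr1 mul1r.
under eq_fun do rewrite exprS.
rewrite pdM//; last exact: trigX.
apply/funext => x; rewrite IHn -[in RHS]natr1 exprS; ring.
Qed.

Lemma pd_cos1 i : pd i (fun x : R * R => cos x.1) = fun x => - i%:R * sin x.1.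
Proof.
apply/funext => x; case: i => /=; [apply: pd1_val|apply: pd2_val] => /=.
  by rewrite mulN1r; exact: is_derive_cos.
by rewrite oppr0 mul0r; exact: is_derive_cst.
Qed.

Lemma pd_sin1 i : pd i (fun x : R * R => sin x.1) = fun x => i%:R * cos x.1.
Proof.
apply/funext => x; case: i => /=; [apply: pd1_val|apply: pd2_val] => /=.
  by rewrite mul1r; exact: is_derive_sin.
by rewrite mul0r; exact: is_derive_cst.
Qed.

Lemma pd_cos2 i : pd i (fun x : R * R => cos x.2) = fun x => - (~~ i)%:R * sin x.2.
Proof.
apply/funext => x; case: i => /=; [apply: pd1_val|apply: pd2_val] => /=.
  by rewrite oppr0 mul0r; exact: is_derive_cst.
by rewrite mulN1r; exact: is_derive_cos.
Qed.

Lemma pd_sin2 i : pd i (fun x : R * R => sin x.2) = fun x => (~~ i)%:R * cos x.2.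
Proof.
apply/funext => x; case: i => /=; [apply: pd1_val|apply: pd2_val] => /=.
  by rewrite mul0r; exact: is_derive_cst.
by rewrite mul1r; exact: is_derive_sin.
Qed.

End trig_calculus.

(** * Derivatives of periodic functions have zero integral *)

Section integ_pd.
Context {R : realType}.
Implicit Types (f g h : sfield R).

Local Notation leb := (@lebesgue_measure R).
Local Notation leb2 := (leb \x leb)%E.
Local Notation Om := (@Omega R : set (measurableTypeR R * measurableTypeR R)).

(** The fundamental theorem of calculus: the boundary values cancel. *)
Lemma integral_derivative_closed (F f : R -> R) :
  (forall s : R, is_derive s 1 F (f s)) -> continuous f -> F (2 * pi) = F 0 ->
  (\int[leb]_(s in `]0%R, (2 * pi)%R[) (f s)%:E = 0)%E.
Proof.
move=> dF cf F2pi.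
have cF : continuous F.
  by move=> s; apply/differentiable_continuous/derivable1_diffP; case: (dF s).
rewrite -(@integral_itv_bndoo _ _ _ _ true false); last first.
  by apply/measurable_EFinP/measurable_funTS; exact: continuous_measurable_fun.
rewrite (@continuous_FTC2 _ f F) ?mulr_gt0 ?pi_gt0//.
- by rewrite F2pi subee.
- exact: continuous_subspaceT.
- split; first by move=> s _; case: (dF s).
  + by apply: cvg_at_right_filter; exact: cF.
  + by apply: cvg_at_left_filter; exact: cF.
- by move=> s _; rewrite derive1E derive_val.
Qed.

(** Inner integral of Fubini's theorem for [pd1 f] extended by zero outside the
    cell: it vanishes on every horizontal line. *)
Lemma integral_patch_pd1 f (y : R) : trig f ->
  (\int[leb]_x (((pd1 f) \_ Om) (x, y))%:E = 0)%E.
Proof.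
move=> tf; have [g tg dg] := trig_derive1 tf.
have -> : pd1 f = g by apply/funext => x; exact: pd1_val.
have [yI|yI] := boolP (y \in `]0, (2 * pi)[); last first.
  apply: integral0_eq => x _; rewrite patchE memNset// => -[_ /= yI'].
  by move: yI; rewrite yI'.
transitivity (\int[leb]_(s in `]0%R, (2 * pi)%R[) (g (s, y))%:E)%E.
  rewrite [RHS]integral_mkcond; apply: eq_integral => x _.
  rewrite !patchE; case: ifPn => /= [/set_mem [/= xI _]|]; first by rewrite mem_set.
  case: ifPn => // /set_mem/= xI /negP[]; exact/mem_set.
apply: (@integral_derivative_closed (fun s => f (s, y)) (fun s => g (s, y))).
- by move=> s; exact: (dg (s, y)).
- move=> s; apply: (@continuous_comp _ _ _ (fun s : R => (s, y)) g).
    by apply: (@cvg_pair _ _ _ (nbhs s) (nbhs s) (nbhs y) _ _ _ id (cst y));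
      [exact: cvg_id|exact: cvg_cst].
  exact: trig_continuous.
- by have [] := trig_periodic tf (0, y); rewrite /= add0r.
Qed.

Lemma integral_patch_pd2 f (x : R) : trig f ->
  (\int[leb]_y (((pd2 f) \_ Om) (x, y))%:E = 0)%E.
Proof.
move=> tf; have [g tg dg] := trig_derive2 tf.
have -> : pd2 f = g by apply/funext => z; exact: pd2_val.
have [xI|xI] := boolP (x \in `]0, (2 * pi)[); last first.
  apply: integral0_eq => y _; rewrite patchE memNset// => -[/= xI' _].
  by move: xI; rewrite xI'.
transitivity (\int[leb]_(s in `]0%R, (2 * pi)%R[) (g (x, s))%:E)%E.
  rewrite [RHS]integral_mkcond; apply: eq_integral => y _.
  rewrite !patchE; case: ifPn => /= [/set_mem [/= _ yI]|]; first by rewrite mem_set.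
  case: ifPn => // /set_mem/= yI /negP[]; exact/mem_set.
apply: (@integral_derivative_closed (fun s => f (x, s)) (fun s => g (x, s))).
- by move=> s; exact: (dg (x, s)).
- move=> s; apply: (@continuous_comp _ _ _ (fun s : R => (x, s)) g).
    by apply: (@cvg_pair _ _ _ (nbhs s) (nbhs x) (nbhs s) _ _ _ (cst x) id);
      [exact: cvg_cst|exact: cvg_id].
  exact: trig_continuous.
- by have [] := trig_periodic tf (x, 0); rewrite /= add0r.
Qed.

(** Fubini reduces the claim to one variable; the order of integration is the one
    that puts the differentiated variable inside. *)
Lemma integ_pd i f : trig f -> integ (pd i f) = 0.
Proof.
move=> tf; have : L1 (pd i f) by exact/bounded_meas_L1/trig_bounded_meas/trig_pd.
rewrite /L1 (integrable_mkcond _ measurable_Omega) /integ Rintegral_mkcond /Rintegral.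
rewrite restrict_EFin => iF; case: i iF => /= iF.
  rewrite -(integral21_prod_meas1 iF)/=.
  by rewrite integral0_eq// => y _; exact: integral_patch_pd1.
rewrite -(integral12_prod_meas1 iF)/=.
by rewrite integral0_eq// => y _; exact: integral_patch_pd2.
Qed.

End integ_pd.

(** * The factors of the convolution kernel *)

Section kernel.
Context {R : realType}.
Implicit Types (f g h : sfield R) (x y : R * R).

Definition pcoord (i : bool) x : R := if i then x.1 else x.2.

(** [(1 + cos t) / 2 = cos^2 (t / 2)] at the difference of the i-th coordinates:
    it is 1 when these agree modulo the period and less than 1 otherwise. *)
Definition havercos (i : bool) x y : R := (1 + cos (pcoord i x - pcoord i y)) / 2.

Lemma trig_cosc i : trig (fun x => cos (pcoord i x)).
Proof. by case: i; [exact: trig_cos1|exact: trig_cos2]. Qed.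

Lemma trig_sinc i : trig (fun x => sin (pcoord i x)).
Proof. by case: i; [exact: trig_sin1|exact: trig_sin2]. Qed.

Lemma pd_cosc j i : pd j (fun x => cos (pcoord i x)) = fun x => - (j == i)%:R * sin (pcoord i x).
Proof. by case: i; [rewrite (pd_cos1 j)|rewrite (pd_cos2 j)]; case: j. Qed.

Lemma pd_sinc j i : pd j (fun x => sin (pcoord i x)) = fun x => (j == i)%:R * cos (pcoord i x).
Proof. by case: i; [rewrite (pd_sin1 j)|rewrite (pd_sin2 j)]; case: j. Qed.

Lemma cos_coordE i x :
  (fun y => cos (pcoord i x - pcoord i y)) =
  (fun y => cos (pcoord i x) * cos (pcoord i y) + sin (pcoord i x) * sin (pcoord i y)).
Proof. by apply/funext => y; rewrite cosB. Qed.

Lemma sin_coordE i x :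
  (fun y => sin (pcoord i x - pcoord i y)) =
  (fun y => sin (pcoord i x) * cos (pcoord i y) + - cos (pcoord i x) * sin (pcoord i y)).
Proof. by apply/funext => y; rewrite sinB mulNr. Qed.

Lemma trig_cos_coord i x : trig (fun y => cos (pcoord i x - pcoord i y)).
Proof.
rewrite cos_coordE; apply: trigD; apply: trigM; try exact: trig_cst.
  exact: trig_cosc.
exact: trig_sinc.
Qed.

Lemma trig_sin_coord i x : trig (fun y => sin (pcoord i x - pcoord i y)).
Proof.
rewrite sin_coordE; apply: trigD; apply: trigM; try exact: trig_cst.
  exact: trig_cosc.
exact: trig_sinc.
Qed.

Lemma pd_cos_coord j i x : pd j (fun y => cos (pcoord i x - pcoord i y)) =
  fun y => (j == i)%:R * sin (pcoord i x - pcoord i y).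
Proof.
have tc := trig_cosc i; have ts := trig_sinc i.
rewrite cos_coordE pdD; [|by apply: trigM => //; exact: trig_cst..].
rewrite !pdZ// pd_cosc pd_sinc; apply/funext => y; rewrite sinB; ring.
Qed.

Lemma pd_sin_coord j i x : pd j (fun y => sin (pcoord i x - pcoord i y)) =
  fun y => - (j == i)%:R * cos (pcoord i x - pcoord i y).
Proof.
have tc := trig_cosc i; have ts := trig_sinc i.
rewrite sin_coordE pdD; [|by apply: trigM => //; exact: trig_cst..].
rewrite !pdZ// pd_cosc pd_sinc; apply/funext => y; rewrite cosB; ring.
Qed.

Lemma trig_havercos i x : trig (havercos i x).
Proof.
apply: trigM; last exact: trig_cst.
by apply: trigD; [exact: trig_cst|exact: trig_cos_coord].
Qed.

Lemma pd_havercos j i x : pd j (havercos i x) =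
  fun y => (j == i)%:R * sin (pcoord i x - pcoord i y) / 2.
Proof.
have tc := trig_cos_coord i x.
rewrite /havercos; rewrite pdM; [|by apply: trigD => //; exact: trig_cst|exact: trig_cst].
rewrite pd_cst pdD//; last exact: trig_cst.
by rewrite pd_cst pd_cos_coord; apply/funext => y; rewrite mulr0 !add0r mulrC.
Qed.

Lemma havercosC i x y : havercos i x y = havercos i y x.
Proof. by rewrite /havercos -opprB cosN. Qed.

Lemma havercos_ge0 i x y : 0 <= havercos i x y.
Proof. by rewrite divr_ge0// -lerBlDl sub0r cos_geN1. Qed.

Lemma integ_trigD f g : trig f -> trig g ->
  integ (fun x => f x + g x) = integ f + integ g.
Proof. by move=> tf tg; apply: integD; exact/bounded_meas_L1/trig_bounded_meas. Qed.

Lemma integ_trigZ c f : trig f -> integ (fun x => c * f x) = c * integ f.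
Proof. by move=> tf; apply: integZ; exact/bounded_meas_L1/trig_bounded_meas. Qed.

(** The derivative of [sin (x - y) * havercos^n] in [y] integrates to zero, and
    [sin^2] is [4 * havercos * (1 - havercos)]: this is the recursion of the Wallis
    integrals.  The factor [f] carries the other variable. *)
Lemma havercos_moment i n x f : trig f -> pd i f = (fun=> 0) ->
  n.+1%:R * integ (fun y => (1 - havercos i x y) * (havercos i x y ^+ n * f y)) =
  2^-1 * integ (fun y => havercos i x y ^+ n * f y).
Proof.
move=> tf df.
have tc := trig_havercos i x; have ts := trig_sin_coord i x.
pose g := fun y => sin (pcoord i x - pcoord i y) * (havercos i x y ^+ n * f y).
have tg : trig g by apply: trigM => //; apply: trigM => //; exact: trigX.
have := integ_pd i tg.
have -> : pd i g = fun y =>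
    2 * n.+1%:R * ((1 - havercos i x y) * (havercos i x y ^+ n * f y)) +
    (-1) * (havercos i x y ^+ n * f y).
  rewrite /g pdM//; last by apply: trigM => //; exact: trigX.
  rewrite pdM//; last exact: trigX.
  rewrite df pd_sin_coord eqxx; apply/funext => y.
  case: n {g tg} => [|n].
    rewrite (_ : (fun y => havercos i x y ^+ 0) = fun=> 1)// pd_cst/=.
    rewrite /havercos; by field.
  rewrite pdX// pd_havercos eqxx !exprS.
  have := cos2Dsin2 (pcoord i x - pcoord i y); rewrite /havercos.
  move: (cos _) (sin _) (_ ^+ n) => c s t e0.
  have e : s * s = 1 - c * c by rewrite -e0; ring.
  rewrite mulr0 add0r /= -[n.+2%:R]natr1.
  transitivity (n.+1%:R * t * f y / 2 * (s * s) - c * ((1 + c) / 2 * t * f y)).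
    by field.
  by rewrite e; field.
have t2 : trig (fun y => havercos i x y ^+ n * f y) by apply: trigM => //; exact: trigX.
have t1 : trig (fun y => (1 - havercos i x y) * (havercos i x y ^+ n * f y)).
  apply: trigM => //; apply: trigD; first exact: trig_cst.
  by under eq_fun do rewrite -mulN1r; apply: trigM => //; exact: trig_cst.
rewrite integ_trigD; [|by apply: trigM => //; exact: trig_cst..].
rewrite !integ_trigZ//; set a := integ _; set b := integ _ => e; lra.
Qed.

End kernel.

(** * The de la Vallee-Poussin kernel *)

Section convolution_kernel.
Context {R : realType}.
Implicit Types (f g h : sfield R) (x y : R * R).

(** The quotient of the integrals over a period of [cos^(2n) (t / 2)] and of 1. *)
Fixpoint wallis (n : nat) : R :=
  if n is m.+1 then wallis m * (1 - (2 * m.+1%:R)^-1) else 1.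

Lemma wallis_gt0 n : 0 < wallis n.
Proof.
elim: n => //= n IHn; rewrite mulr_gt0// subr_gt0 invf_lt1 ?mulr_gt0//.
by rewrite -natrM ltr1n mulnS.
Qed.

(** [havercos_moment] is a recursion on the exponent which does not see [x]; this is
    why the mass of the kernel is the same around every point. *)
Lemma integ_havercosX i n x f : trig f -> pd i f = (fun=> 0) ->
  integ (fun y => havercos i x y ^+ n * f y) = wallis n * integ f.
Proof.
move=> tf df; elim: n => [|n IHn].
  by rewrite /= mul1r; congr integ; apply/funext => y; rewrite mul1r.
have tc := trig_havercos i x.
have t2 : trig (fun y => havercos i x y ^+ n * f y) by apply: trigM => //; exact: trigX.
have t1 : trig (fun y => (1 - havercos i x y) * (havercos i x y ^+ n * f y)).
  apply: trigM => //; apply: trigD; first exact: trig_cst.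
  by under eq_fun do rewrite -mulN1r; apply: trigM => //; exact: trig_cst.
transitivity (integ (fun y => havercos i x y ^+ n * f y +
   (-1) * ((1 - havercos i x y) * (havercos i x y ^+ n * f y)))).
  by congr integ; apply/funext => y; rewrite exprS; ring.
rewrite integ_trigD//; last by apply: trigM => //; exact: trig_cst.
rewrite integ_trigZ// /=.
have /(congr1 (fun z => n.+1%:R^-1 * z)) := havercos_moment n x tf df.
rewrite mulKf ?pnatr_eq0// => ->; rewrite IHn; field.
by rewrite nat1r pnatr_eq0.
Qed.

Definition area : R := integ (fun=> 1).

Lemma area_gt0 : 0 < area.
Proof.
suff -> : area = (2 * pi) * (2 * pi) by rewrite !mulr_gt0// pi_gt0.
rewrite /area /integ Rintegral_cst ?mul1r; last exact: measurable_Omega.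
by rewrite -[RHS]/(fine ((2 * pi) * (2 * pi))%:E); congr fine; exact: leb2_Omega.
Qed.

(** The tensor product of two normalized de la Vallee-Poussin kernels. *)
Definition vp_kernel (n : nat) x y : R :=
  (wallis n ^+ 2 * area)^-1 * (havercos true x y ^+ n * havercos false x y ^+ n).

Lemma vp_kernel_ge0 n x y : 0 <= vp_kernel n x y.
Proof.
apply: mulr_ge0; last by rewrite mulr_ge0 ?exprn_ge0 ?havercos_ge0.
by rewrite invr_ge0 ltW// mulr_gt0 ?area_gt0// exprn_gt0 ?wallis_gt0.
Qed.

Lemma vp_kernelC n x y : vp_kernel n x y = vp_kernel n y x.
Proof. by rewrite /vp_kernel 2!(havercosC _ x). Qed.

Lemma trig_vp_kernel n x : trig (vp_kernel n x).
Proof.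
apply: trigM; first exact: trig_cst.
by apply: trigM; apply: trigX; exact: trig_havercos.
Qed.

Lemma pd_havercosX_neq i n x : pd i (fun y => havercos (~~ i) x y ^+ n) = fun=> 0.
Proof.
case: n => [|n].
  by rewrite (_ : (fun y => havercos (~~ i) x y ^+ 0) = fun=> 1)// pd_cst.
rewrite pdX; last exact: trig_havercos.
apply/funext => y; rewrite pd_havercos; case: i => /=; by rewrite !mul0r mulr0.
Qed.

Lemma integ_havercosX2 i n x :
  integ (fun y => havercos i x y ^+ n * havercos (~~ i) x y ^+ n) = wallis n ^+ 2 * area.
Proof.
rewrite integ_havercosX; last 2 first.
- by apply: trigX; exact: trig_havercos.
- exact: pd_havercosX_neq.
rewrite expr2 -mulrA; congr (_ * _).
rewrite -[RHS](@integ_havercosX (~~ i) n x (fun=> 1)); last 2 first.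
- exact: trig_cst.
- exact: pd_cst.
by congr integ; apply/funext => y; rewrite mulr1.
Qed.

Lemma vp_kernelE i n x y : vp_kernel n x y =
  (wallis n ^+ 2 * area)^-1 * (havercos i x y ^+ n * havercos (~~ i) x y ^+ n).
Proof. by case: i => //; rewrite /vp_kernel; congr (_ * _); rewrite mulrC. Qed.

Lemma wallis_area_neq0 n : wallis n ^+ 2 * area != 0.
Proof. by rewrite mulf_neq0 ?expf_neq0 ?gt_eqF ?wallis_gt0 ?area_gt0. Qed.

Lemma integ_vp_kernel n x : integ (vp_kernel n x) = 1.
Proof.
rewrite integ_trigZ; last by apply: trigM; apply: trigX; exact: trig_havercos.
by rewrite (integ_havercosX2 true) mulVf// wallis_area_neq0.
Qed.

(** The kernel concentrates on the diagonal, at an explicit rate. *)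
Lemma integ_vp_kernel_moment i n x :
  integ (fun y => (1 - havercos i x y) * vp_kernel n x y) = (2 * n.+1%:R)^-1.
Proof.
set c := (wallis n ^+ 2 * area)^-1.
have tc := trig_havercos i x.
have t2 : trig (fun y => havercos i x y ^+ n * havercos (~~ i) x y ^+ n).
  by apply: trigM; apply: trigX; exact: trig_havercos.
have -> : (fun y => (1 - havercos i x y) * vp_kernel n x y) =
    fun y => c * ((1 - havercos i x y) * (havercos i x y ^+ n * havercos (~~ i) x y ^+ n)).
  by apply/funext => y; rewrite (vp_kernelE i) -/c; ring.
rewrite integ_trigZ; last first.
  apply: trigM => //; apply: trigD; first exact: trig_cst.
  by under eq_fun do rewrite -mulN1r; apply: trigM => //; exact: trig_cst.
have tX : trig (fun y => havercos (~~ i) x y ^+ n) by apply: trigX; exact: trig_havercos.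
have := havercos_moment n x tX (pd_havercosX_neq i n x).
rewrite integ_havercosX2 => /(congr1 (fun z => n.+1%:R^-1 * z)).
rewrite mulKf ?pnatr_eq0// => ->.
by rewrite invfM mulrCA [c * _]mulrCA mulVf ?wallis_area_neq0// mulr1 mulrC.
Qed.

(** Kernels of finite rank over trigonometric polynomials.  Integrating such a
    kernel against a function gives a finite sum, which turns differentiation
    under the integral sign and exchange of integrals into linearity. *)
Definition degenerate (K : R * R -> sfield R) : Prop :=
  exists (I : Type) (s : seq I) (A B : I -> sfield R),
    [/\ forall i, trig (A i), forall i, trig (B i)
      & forall x y, K x y = \sum_(i <- s) A i x * B i y].

Lemma degenerateM K L : degenerate K -> degenerate L ->
  degenerate (fun x y => K x y * L x y).
Proof.
move=> [I [s [A [B [tA tB KE]]]]] [J [t [C [D [tC tD LE]]]]].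
exists (I * J)%type, [seq (i, j) | i <- s, j <- t].
exists (fun ij x => A ij.1 x * C ij.2 x), (fun ij x => B ij.1 x * D ij.2 x).
split => [ij|ij|x y]; [exact: trigM|exact: trigM|].
rewrite KE LE big_allpairs_dep/= mulr_suml; apply: eq_bigr => i _.
by rewrite mulr_sumr; apply: eq_bigr => j _; ring.
Qed.

Lemma degenerate_cst (c : R) : degenerate (fun _ _ => c).
Proof.
exists unit, [:: tt], (fun _ _ => c), (fun _ _ => 1).
by split => [_|_|x y]; [exact: trig_cst|exact: trig_cst|rewrite big_seq1 mulr1].
Qed.

Lemma degenerateX K n : degenerate K -> degenerate (fun x y => K x y ^+ n).
Proof.
move=> dK; elim: n => [|n IHn]; first exact: degenerate_cst.
rewrite (_ : (fun x y => _) = fun x y => K x y * K x y ^+ n); first exact: degenerateM.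
by apply/funext => x; apply/funext => y; rewrite exprS.
Qed.

(** The addition formula [cos (x - y) = cos x cos y + sin x sin y]. *)
Lemma degenerate_havercos i : degenerate (havercos i).
Proof.
exists (option bool), [:: None; Some true; Some false].
exists (fun o x => if o is Some b then if b then cos (pcoord i x) else sin (pcoord i x) else 1).
exists (fun o x => 2^-1 *
  if o is Some b then if b then cos (pcoord i x) else sin (pcoord i x) else 1).
split => [[[]|]|[[]|]|x y].
- exact: trig_cosc.
- exact: trig_sinc.
- exact: trig_cst.
- by apply: trigM; [exact: trig_cst|exact: trig_cosc].
- by apply: trigM; [exact: trig_cst|exact: trig_sinc].
- by apply: trigM; exact: trig_cst.
- by rewrite /havercos cosB !big_cons big_nil; field.
Qed.

Lemma degenerate_vp_kernel n : degenerate (vp_kernel n).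
Proof.
apply: degenerateM; first exact: degenerate_cst.
by apply: degenerateM; apply: degenerateX; exact: degenerate_havercos.
Qed.

(** The kernel depends on [x - y] only. *)
Lemma pd_vp_kernel_antisym i n x y : pd i (vp_kernel n ^~ y) x = - pd i (vp_kernel n x) y.
Proof.
have e z : vp_kernel n ^~ z = vp_kernel n z by apply/funext => t; rewrite vp_kernelC.
have dX m j z t : pd i (fun y => havercos j z y ^+ m) t = - pd i (fun y => havercos j t y ^+ m) z.
  case: m => [|m].
    have X0 s : pd i (fun y => havercos j s y ^+ 0) = fun=> 0 by exact: pd_cst.
    by rewrite (X0 z) oppr0.
  rewrite !pdX; [|exact: trig_havercos..].
  rewrite !pd_havercos havercosC -(opprB (pcoord j t)) sinN; ring.
rewrite e /vp_kernel !pdZ; [|by apply: trigM; apply: trigX; exact: trig_havercos..].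
rewrite !pdM; [|by apply: trigX; exact: trig_havercos..].
by rewrite !(dX _ _ y x) !(havercosC _ y x); ring.
Qed.

End convolution_kernel.

(** * Uniform approximation of continuous periodic functions *)

Section korovkin.
Context {R : realType}.
Implicit Types (a b f g h : sfield R) (x y : R * R).

(** [1 - cos t = 2 sin^2 (t / 2)], and the sine is positive inside [(0, pi)]. *)
Lemma cos_eq1_itv (t : R) : - (2 * pi) <= t <= 2 * pi -> cos t = 1 ->
  [\/ t = 0, t = 2 * pi | t = - (2 * pi)].
Proof.
wlog t0 : t / 0 <= t => [wl /andP[tl tr] ct|].
  have [t0|/ltW t0] := leP 0 t; first by apply: wl => //; rewrite tl.
  have [|||nt|nt|nt] := wl (- t).
  - by rewrite oppr_ge0.
  - by rewrite lerN2 tr lerNl tl.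
  - by rewrite cosN.
  - by apply: Or31; apply/eqP; rewrite -oppr_eq0 nt.
  - by apply: Or33; rewrite -nt opprK.
  - by apply: Or32; apply: oppr_inj.
move=> /andP[_ tr] ct.
have [->|tn0] := eqVneq t 0; first exact: Or31.
have [->|tn2] := eqVneq t (2 * pi); first exact: Or32.
have : 0 < sin (t / 2).
  have t1 : 0 < t by rewrite lt_def tn0.
  have t2 : t < 2 * pi by rewrite lt_neqAle tn2.
  by apply: sin_gt0_pi; apply/andP; split; lra.
have : cos t = 1 - 2 * sin (t / 2) ^+ 2.
  rewrite {1}(_ : t = (t / 2) *+ 2); last by rewrite mulr2n -splitr.
  by have := cos2Dsin2 (t / 2); rewrite cos_mulr2n -[_ *+ 2]mulr_natl; lra.
rewrite ct; move: (sin _) => s e s0; exfalso.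
have : 0 < s ^+ 2 by rewrite exprn_gt0.
lra.
Qed.

Definition square : set (R * R) := `[0, 2 * pi] `*` `[0, 2 * pi].

Lemma compact_square : compact square.
Proof. by apply: compact_setX; exact: segment_compact. Qed.

Lemma Omega_square x : Omega x -> square x.
Proof. by move=> [/= ? ?]; split; exact: subset_itv_oo_cc. Qed.

Lemma continuous_bounded_square a : continuous a ->
  exists2 M : R, 0 < M & forall x, square x -> `|a x| <= M.
Proof.
move=> ca; have : compact (a @` square).
  apply: continuous_compact; last exact: compact_square.
  exact: continuous_subspaceT.
move=> /compact_bounded[M [_ Mb]]; exists (`|M| + 1).
  by rewrite ltr_pwDr.
by move=> x Sx; apply: (Mb (`|M| + 1)); [rewrite ltr_pwDr// ler_norm|exists x].
Qed.

(** Vanishes exactly when [x] and [y] are the same point of the torus, and is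
    integrated exactly by [integ_vp_kernel_moment]. *)
Definition torus_gap x y : R := (1 - havercos true x y) + (1 - havercos false x y).

Lemma havercos_le1 i x y : havercos i x y <= 1.
Proof. by rewrite ler_pdivrMr// mul1r -lerBrDl [2 - 1]addrK cos_le1. Qed.

Lemma torus_gap_ge0 x y : 0 <= torus_gap x y.
Proof. by rewrite addr_ge0// subr_ge0 havercos_le1. Qed.

Lemma torus_gap_eq0 a x y : periodic2 a -> square x -> square y ->
  torus_gap x y = 0 -> a x = a y.
Proof.
have havercos1 i z t : havercos i z t = 1 -> cos (pcoord i z - pcoord i t) = 1.
  by rewrite /havercos; move: (cos _) => c; lra.
move=> pa [/= + +] [/= + +] /eqP.
rewrite paddr_eq0 ?subr_ge0 ?havercos_le1// !subr_eq0 => + + + + /andP[].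
move=> + + + + /eqP/esym/havercos1/= c1 /eqP/esym/havercos1/= c2.
rewrite !in_itv/=; move: x y c1 c2 => [x1 x2] [y1 y2]/= c1 c2.
move=> /andP[lx1 rx1] /andP[lx2 rx2] /andP[ly1 ry1] /andP[ly2 ry2].
have h1 : [\/ x1 = y1, x1 = y1 + 2 * pi | y1 = x1 + 2 * pi].
  have [|e|e|e] := cos_eq1_itv _ c1; first by apply/andP; split; lra.
  - by apply: Or31; lra.
  - by apply: Or32; lra.
  - by apply: Or33; lra.
have h2 : [\/ x2 = y2, x2 = y2 + 2 * pi | y2 = x2 + 2 * pi].
  have [|e|e|e] := cos_eq1_itv _ c2; first by apply/andP; split; lra.
  - by apply: Or31; lra.
  - by apply: Or32; lra.
  - by apply: Or33; lra.
have e1 (s t1 t2 : R) : [\/ t1 = t2, t1 = t2 + 2 * pi | t2 = t1 + 2 * pi] ->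
    a (t1, s) = a (t2, s).
  by case=> ->//; [have [/= -> _] := pa (t2, s)|have [/= -> _] := pa (t1, s)].
have e2 (s t1 t2 : R) : [\/ t1 = t2, t1 = t2 + 2 * pi | t2 = t1 + 2 * pi] ->
    a (s, t1) = a (s, t2).
  by case=> ->//; [have [/= _ ->] := pa (s, t2)|have [/= _ ->] := pa (s, t1)].
by rewrite (e1 _ _ y1)// (e2 _ _ y2).
Qed.

Lemma continuous_torus_gap : continuous (fun z : (R * R) * (R * R) => torus_gap z.1 z.2).
Proof.
have cc i : continuous (fun z : (R * R) * (R * R) => havercos i z.1 z.2).
  move=> z; apply: cvgM; last exact: cvg_cst.
  apply: cvgD; first exact: cvg_cst.
  apply: (continuous_comp (f := fun z : (R * R) * (R * R) => pcoord i z.1 - pcoord i z.2));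
    last exact: continuous_cos.
  apply: cvgB; case: i => /=.
  - by apply: (continuous_comp (f := fst) (g := fst)); exact: cvg_fst.
  - by apply: (continuous_comp (f := fst) (g := snd)); [exact: cvg_fst|exact: cvg_snd].
  - by apply: (continuous_comp (f := snd) (g := fst)); [exact: cvg_snd|exact: cvg_fst].
  - by apply: (continuous_comp (f := snd) (g := snd)); exact: cvg_snd.
by move=> z; apply: cvgD; apply: cvgB; (exact: cvg_cst || exact: cc).
Qed.

(** On the compact set of pairs where [a] varies by at least [e], the two points
    differ on the torus, so the gap has a positive lower bound there. *)
Lemma korovkin_modulus a (e : R) : continuous a -> periodic2 a -> 0 < e ->
  exists2 C : R, 0 < C & forall x y, square x -> square y ->
    `|a y - a x| <= e + C * torus_gap x y.
Proof.
move=> ca pa e0; have [M M0 aM] := continuous_bounded_square ca.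
pose far := (square `*` square) `&` [set z | e <= `|a z.2 - a z.1|].
have cfar : compact far.
  rewrite /far; apply: compact_closedI; first by apply: compact_setX; exact: compact_square.
  apply: (@closed_comp _ _ (fun z : (R * R) * (R * R) => `|a z.2 - a z.1|) [set r | e <= r]).
    move=> z _; apply: (continuous_comp (f := fun z : (R * R) * (R * R) => a z.2 - a z.1));
      last exact: norm_continuous.
    by apply: cvgB; [apply: (continuous_comp (f := snd)); [exact: cvg_snd|exact: ca]
                    |apply: (continuous_comp (f := fst)); [exact: cvg_fst|exact: ca]].
  exact: closed_ge.
have : compact ((fun z : (R * R) * (R * R) => torus_gap z.1 z.2) @` far).
  by apply: continuous_compact => //; apply: continuous_subspaceT; exact: continuous_torus_gap.
move=> /(compact_closed (@Rhausdorff R)) /closed_openC oD.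
have [r /= r0 far_r] : \forall t \near (0 : R),
    (~` ((fun z : (R * R) * (R * R) => torus_gap z.1 z.2) @` far)) t.
  apply: open_nbhs_nbhs; split => // -[[x y] [[/= Sx Sy] /= exy] /= dxy].
  by move: exy; rewrite (torus_gap_eq0 pa Sx Sy dxy) subrr normr0 leNgt e0.
exists (2 * M / r); first by rewrite divr_gt0// mulr_gt0.
move=> x y Sx Sy; have [lt_e|ge_e] := ltP `|a y - a x| e.
  by rewrite ler_wpDr ?(ltW lt_e)// mulr_ge0 ?torus_gap_ge0// ltW// divr_gt0// mulr_gt0.
have rd : r <= torus_gap x y.
  rewrite leNgt; apply/negP => dr; apply: (far_r (torus_gap x y)).
    by rewrite /ball_ /= sub0r normrN ger0_norm ?torus_gap_ge0.
  by exists (x, y).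
apply: (@le_trans _ _ (2 * M / r * r)).
  rewrite divfK ?gt_eqF// mulrDl !mul1r (le_trans (ler_normB _ _))// lerD// aM//.
by rewrite ler_wpDl ?(ltW e0)// ler_pM2l// divr_gt0// mulr_gt0.
Qed.

Lemma continuous_bounded_meas a :
  measurable_fun [set: measurableTypeR R * measurableTypeR R] a ->
  continuous a -> bounded_meas a.
Proof.
move=> ma ca; split => //; have [M _ aM] := continuous_bounded_square ca.
by exists M => x /Omega_square; exact: aM.
Qed.

(** Korovkin's argument: average the bound of [korovkin_modulus] against the kernel, which
    is nonnegative and of total mass one. *)
Lemma vp_kernel_approx a (e : R) : bounded_meas a -> continuous a -> periodic2 a -> 0 < e ->
  exists N, forall n, (N <= n)%N ->
    forall x, Omega x -> `|ip a (vp_kernel n x) - a x| <= e.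
Proof.
move=> ba ca pa e0; have e20 : 0 < e / 2 by rewrite divr_gt0.
have [C C0 aC] := korovkin_modulus ca pa e20.
have [N CN] : exists N, forall n, (N <= n)%N -> C / n.+1%:R <= e / 2.
  have tr := archi_boundP (ltW (divr_gt0 C0 e20)).
  exists (Num.bound (C / (e / 2))) => n Nn; rewrite ler_pdivrMr// mulrC -ler_pdivrMr//.
  by apply/ltW/(lt_trans tr); rewrite ltr_nat ltnS.
exists N => n /CN Cn x Ox; have Sx := Omega_square Ox.
have tk := trig_vp_kernel n x.
have kL : L1 (vp_kernel n x) by exact/bounded_meas_L1/trig_bounded_meas.
have momL i : L1 (fun y => (1 - havercos i x y) * vp_kernel n x y).
  apply: L1M => //; apply: bounded_measD; first exact: bounded_meas_cst.
  under eq_fun do rewrite -mulN1r.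
  by apply: bounded_measM; [exact: bounded_meas_cst|exact/trig_bounded_meas/trig_havercos].
have akL : L1 (fun y => a y * vp_kernel n x y) by exact: L1M.
have -> : ip a (vp_kernel n x) - a x = integ (fun y => (a y - a x) * vp_kernel n x y).
  rewrite -[X in _ - X]mulr1 -(integ_vp_kernel n x) -integZ// -integB//; last exact: L1Z.
  by congr integ; apply/funext => y; rewrite mulrBl.
apply: le_trans (le_norm_integ _) _.
  apply: L1M => //; apply: bounded_measD => //; exact: bounded_meas_cst.
apply: (@le_trans _ _ (integ (fun y => e / 2 * vp_kernel n x y +
   (C * ((1 - havercos true x y) * vp_kernel n x y) +
    C * ((1 - havercos false x y) * vp_kernel n x y))))).
  apply: le_integ.
  - apply: L1_norm; apply: L1M => //; apply: bounded_measD => //; exact: bounded_meas_cst.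
  - by apply: L1D; [exact: L1Z|apply: L1D; exact: L1Z].
  - move=> y Oy; rewrite normrM (ger0_norm (vp_kernel_ge0 _ _ _)).
    rewrite [leRHS](_ : _ = (e / 2 + C * torus_gap x y) * vp_kernel n x y);
      last by rewrite /torus_gap; ring.
    by apply: ler_wpM2r; [exact: vp_kernel_ge0|apply: aC => //; exact: Omega_square].
rewrite integD; [|exact: L1Z|by apply: L1D; exact: L1Z].
rewrite integD; [|exact: L1Z..].
rewrite (integZ (e / 2) kL) (integZ C (momL true)) (integZ C (momL false)).
rewrite integ_vp_kernel !integ_vp_kernel_moment mulr1.
have -> : C / (2 * n.+1%:R) = (C / n.+1%:R) / 2 by rewrite invfM mulrCA mulrC.
move: (C / n.+1%:R) Cn => c; lra.
Qed.

End korovkin.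

(** * Weak derivatives of products *)

Section weak_derivative.
Context {R : realType}.
Implicit Types (a b f g h u w : sfield R) (x y : R * R).

(** Weak partial derivative tested with trigonometric polynomials only.  This is
    implied by the definition with all smooth periodic test functions. *)
Definition wderiv (i : bool) f g : Prop :=
  forall phi, trig phi -> ip f (pd i phi) = - ip g phi.

Definition cont_periodic f : Prop := [/\ bounded_meas f, continuous f & periodic2 f].

Lemma trig_cont_periodic f : trig f -> cont_periodic f.
Proof.
by move=> tf; split;
  [exact: trig_bounded_meas|exact: trig_continuous|exact: trig_periodic].
Qed.

Lemma cont_periodicM f g : cont_periodic f -> cont_periodic g ->
  cont_periodic (fun x => f x * g x).
Proof.
move=> [bf cf pf] [bg cg pg]; split; first exact: bounded_measM.
  by move=> x; apply: cvgM; [exact: cf|exact: cg].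
by move=> x; have [f1 f2] := pf x; have [g1 g2] := pg x; rewrite f1 f2 g1 g2.
Qed.

Lemma ip_sum (I : Type) (s : seq I) (c : I -> R) (F : I -> sfield R) h :
  L1 h -> (forall j, trig (F j)) ->
  ip h (fun x => \sum_(j <- s) c j * F j x) = \sum_(j <- s) c j * ip h (F j).
Proof.
move=> hL tF; have hFL j : L1 (fun x => h x * F j x).
  by apply: L1Mr => //; exact: trig_bounded_meas.
transitivity (integ (fun x => \sum_(j <- s) c j * (h x * F j x))).
  congr integ; apply/funext => x; rewrite mulr_sumr.
  by apply: eq_bigr => j _; rewrite mulrCA.
rewrite integ_sum; last by move=> j; exact: L1Z.
by apply: eq_bigr => j _; rewrite integZ.
Qed.

(** Integration by parts with regularized functions.  Write [K b] for
    [fun x => ip b (vp_kernel n x)].  Test the weak derivative of [a] with the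
    trigonometric polynomial [K b]; its derivative is [K gb], because moving a
    derivative of the kernel from [x] to [y] changes its sign; finally move [K]
    from [gb] to [a], by symmetry of the kernel. *)
Lemma wderiv_regularized i n a b ga gb : bounded_meas a -> bounded_meas b -> L1 ga -> L1 gb ->
  wderiv i a ga -> wderiv i b gb ->
  ip gb (fun y => ip a (vp_kernel n y)) = - ip ga (fun x => ip b (vp_kernel n x)).
Proof.
move=> ba bb gaL gbL da db.
have [I [s [A [B [tA tB KE]]]]] := @degenerate_vp_kernel R n.
have aL := bounded_meas_L1 ba; have bL := bounded_meas_L1 bb.
have KEy x : vp_kernel n x = fun y => \sum_(j <- s) A j x * B j y.
  by apply/funext => y; rewrite KE.
have KEx y : vp_kernel n ^~ y = fun x => \sum_(j <- s) B j y * A j x.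
  by apply/funext => x; rewrite KE; apply: eq_bigr => j _; rewrite mulrC.
have bnE : (fun x => ip b (vp_kernel n x)) = fun x => \sum_(j <- s) ip b (B j) * A j x.
  apply/funext => x; rewrite KEy ip_sum//.
  by apply: eq_bigr => j _; rewrite mulrC.
have anE : (fun y => ip a (vp_kernel n y)) = fun y => \sum_(j <- s) ip a (A j) * B j y.
  apply/funext => y; rewrite (_ : vp_kernel n y = vp_kernel n ^~ y).
    by rewrite KEx ip_sum//; apply: eq_bigr => j _; rewrite mulrC.
  by apply/funext => x; rewrite vp_kernelC.
have tbn : trig (fun x => ip b (vp_kernel n x)).
  by rewrite bnE; apply: trig_sum => j; apply: trigM => //; exact: trig_cst.
have dbn : pd i (fun x => ip b (vp_kernel n x)) = fun x => \sum_(j <- s) ip gb (B j) * A j x.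
  rewrite bnE pd_sum; last by move=> j; apply: trigM => //; exact: trig_cst.
  apply/funext => x.
  transitivity (ip b (fun y => \sum_(j <- s) pd i (A j) x * B j y)).
    rewrite ip_sum//; apply: eq_bigr => j _; rewrite pdZ// mulrC//.
  transitivity (- ip b (pd i (vp_kernel n x))).
    rewrite /ip -integN; last first.
      by apply: L1M => //; apply/bounded_meas_L1/trig_bounded_meas/trig_pd/trig_vp_kernel.
    congr integ; apply/funext => y; rewrite -mulrN -pd_vp_kernel_antisym KEx.
    rewrite pd_sum; last by move=> j; apply: trigM => //; exact: trig_cst.
    by congr (_ * _); apply: eq_bigr => j _; rewrite pdZ// mulrC.
  rewrite db; last exact: trig_vp_kernel.
  rewrite opprK KEy ip_sum//.
  by apply: eq_bigr => j _; rewrite mulrC.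
rewrite -da// dbn anE !ip_sum//.
by apply: eq_bigr => j _; rewrite mulrC.
Qed.

Lemma ip_close (e : R) h a b : L1 h -> bounded_meas a -> bounded_meas b ->
  (forall x, Omega x -> `|b x - a x| <= e) ->
  `|ip h b - ip h a| <= e * integ (fun x => `|h x|).
Proof.
move=> hL ba bb ab; rewrite /ip -integB; [|exact: L1Mr..].
have dL : L1 (fun x => h x * b x - h x * a x) by apply: L1B; exact: L1Mr.
apply: le_trans (le_norm_integ dL) _; rewrite -integZ; last exact: L1_norm.
apply: le_integ; [exact: L1_norm|by apply: L1Z; exact: L1_norm|].
move=> x Ox; rewrite -mulrBr normrM mulrC; apply: ler_wpM2r => //; exact: ab.
Qed.

(** Limit of [wderiv_regularized]: the regularizations of [a] and [b] converge
    uniformly while the weak derivatives are merely integrable. *)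
Lemma wderiv_parts i a b ga gb : cont_periodic a -> cont_periodic b -> L1 ga -> L1 gb ->
  wderiv i a ga -> wderiv i b gb -> ip a gb = - ip ga b.
Proof.
move=> [ba ca pa] [bb cb pb] gaL gbL da db; apply/eqP; rewrite -subr_eq0 opprK.
rewrite -normr_le0; apply/ler_addgt0Pr => e e0; rewrite add0r.
pose D := integ (fun x => `|ga x|) + integ (fun x => `|gb x|) + 1.
have D0 : 0 < D by rewrite ltr_wpDl// addr_ge0// integ_ge0.
have eD0 : 0 < e / D by rewrite divr_gt0.
have [N aN] := vp_kernel_approx ba ca pa eD0.
have [M bM] := vp_kernel_approx bb cb pb eD0.
pose n := maxn N M.
have {}aN := aN n (leq_maxl _ _); have {}bM := bM n (leq_maxr _ _).
have bddk h : bounded_meas h -> bounded_meas (fun x => ip h (vp_kernel n x)).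
  move=> bh; have [I [s [A [B [tA tB KE]]]]] := @degenerate_vp_kernel R n.
  rewrite (_ : (fun x => _) = fun x => \sum_(j <- s) ip h (B j) * A j x).
    by apply: trig_bounded_meas; apply: trig_sum => j; apply: trigM => //; exact: trig_cst.
  apply/funext => x; rewrite (_ : vp_kernel n x = fun y => \sum_(j <- s) A j x * B j y).
    by rewrite ip_sum//; [apply: eq_bigr => j _; rewrite mulrC|exact: bounded_meas_L1].
  by apply/funext => y; rewrite KE.
have := ip_close gbL ba (bddk _ ba) aN; have := ip_close gaL bb (bddk _ bb) bM.
rewrite (wderiv_regularized n ba bb gaL gbL da db) (ipC a).
move: (ip ga (fun x => _)) (ip ga b) (ip gb a) => s t r.
set na := integ _; set nb := integ _ => hs hr.
apply: (@le_trans _ _ (e / D * na + e / D * nb)).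
  rewrite (_ : r + t = - (s - t) - (- s - r)); last by ring.
  by apply: le_trans (ler_normB _ _) _; rewrite normrN lerD.
rewrite -mulrDr mulrAC ler_pdivrMr// ler_pM2l// /D.
by rewrite lerDl.
Qed.

Lemma wderivM_trig i w g phi : cont_periodic w -> L1 g -> trig phi -> wderiv i w g ->
  wderiv i (fun x => w x * phi x) (fun x => g x * phi x + w x * pd i phi x).
Proof.
move=> [bw _ _] gL tphi dw psi tpsi.
have tp := trigM tphi tpsi.
have := dw _ tp; rewrite pdM// /ip.
have L f : bounded_meas f -> L1 (fun x => w x * f x).
  by move=> bf; apply/bounded_meas_L1/bounded_measM.
have d1 := trig_pd i tphi; have d2 := trig_pd i tpsi.
have -> : (fun x => w x * (phi x * pd i psi x + psi x * pd i phi x)) =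
  (fun x => w x * (phi x * pd i psi x) + w x * (psi x * pd i phi x)).
  by apply/funext => x; rewrite mulrDr.
rewrite integD; [|by apply/L/trig_bounded_meas/trigM..].
have -> : (fun x => (g x * phi x + w x * pd i phi x) * psi x) =
  (fun x => g x * (phi x * psi x) + w x * (psi x * pd i phi x)).
  by apply/funext => x; ring.
rewrite integD;
  [|by apply: L1Mr => //; exact: trig_bounded_meas|by apply/L/trig_bounded_meas/trigM].
have -> : (fun x => w x * phi x * pd i psi x) = (fun x => w x * (phi x * pd i psi x)).
  by apply/funext => x; rewrite mulrA.
by move: (integ _) (integ _) (integ _) => r s t; lra.
Qed.

(** Write [u * w * D phi] as [u * D (w phi) - u * phi * D w] and apply
    [wderiv_parts] to [u] and [w * phi]. *)
Lemma wderivM i u w gu gw : cont_periodic u -> cont_periodic w -> L1 gu -> L1 gw ->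
  wderiv i u gu -> wderiv i w gw ->
  wderiv i (fun x => u x * w x) (fun x => gu x * w x + u x * gw x).
Proof.
move=> nu nw guL gwL du dw phi tphi.
have [bu _ _] := nu; have [bw _ _] := nw; have bphi := trig_bounded_meas tphi.
have bdphi := trig_bounded_meas (trig_pd i tphi).
have e := wderiv_parts nu (cont_periodicM nw (trig_cont_periodic tphi)) guL _ du
  (wderivM_trig nw gwL tphi dw).
have {e} := e (L1D (L1Mr gwL bphi) (bounded_meas_L1 (bounded_measM bw bdphi))).
rewrite /ip.
have -> : (fun x => u x * (gw x * phi x + w x * pd i phi x)) =
  (fun x => u x * gw x * phi x + u x * w x * pd i phi x).
  by apply/funext => x; ring.
have ugL : L1 (fun x => u x * gw x * phi x) by apply: L1Mr => //; exact: L1M.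
rewrite integD//; last by apply: bounded_meas_L1; apply: bounded_measM => //; exact: bounded_measM.
have -> : (fun x => (gu x * w x + u x * gw x) * phi x) =
  (fun x => gu x * (w x * phi x) + u x * gw x * phi x).
  by apply/funext => x; ring.
rewrite integD//; last by apply: L1Mr => //; exact: bounded_measM.
by move: (integ _) (integ _) (integ _) => r s t; lra.
Qed.

(** Twice the left-hand side is the integral of the weak derivative of
    [u * w^2]: this is [wderiv_parts] for [u] and [w * w]. *)
Lemma wderiv_transport i u w gu gw : cont_periodic u -> cont_periodic w -> L1 gu -> L1 gw ->
  wderiv i u gu -> wderiv i w gw ->
  ip (fun x => u x * gw x) w + 2^-1 * ip (fun x => gu x * w x) w = 0.
Proof.
move=> nu nw guL gwL du dw.
have [bu _ _] := nu; have [bw _ _] := nw.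
have wL : L1 (fun x => gw x * w x + w x * gw x) by apply: L1D; [exact: L1Mr|exact: L1M].
have := wderiv_parts nu (cont_periodicM nw nw) guL wL du (wderivM nw nw gwL gwL dw dw).
have -> : ip u (fun x => gw x * w x + w x * gw x) = 2 * ip (fun x => u x * gw x) w.
  rewrite /ip -integZ; last by apply: L1Mr => //; exact: L1M.
  by congr integ; apply/funext => x; ring.
have -> : ip gu (fun x => w x * w x) = ip (fun x => gu x * w x) w.
  by rewrite /ip; congr integ; apply/funext => x; ring.
lra.
Qed.

End weak_derivative.

(** * Square integrable fields *)

Section inner_product.
Context {R : realType}.
Implicit Types (f g h w : sfield R) (u v F : vfield R).

Definition L2v v : Prop := L2 v.1 /\ L2 v.2.

Lemma L2vB u v : L2v u -> L2v v -> L2v (u - v).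
Proof. by move=> [u1 u2] [v1 v2]; split; exact: L2B. Qed.

Lemma L2zv_L2v v : L2zv v -> L2v v.
Proof. by move=> [[v1 _] [v2 _]]; split; exact: L2perL2. Qed.

Lemma ip_ge0 f : 0 <= ip f f.
Proof. by apply: integ_ge0 => x _; rewrite -expr2 sqr_ge0. Qed.

Lemma ipv_ge0 v : 0 <= ipv v v.
Proof. by rewrite addr_ge0// ip_ge0. Qed.

Lemma normL2_sqr f : normL2 f ^+ 2 = ip f f.
Proof. by rewrite sqr_sqrtr// ip_ge0. Qed.

Lemma normL2v_sqr v : normL2v v ^+ 2 = ipv v v.
Proof. by rewrite sqr_sqrtr// ipv_ge0. Qed.

Lemma normgradv_sqr v : normgradv v ^+ 2 = ipgrad v v.
Proof. by rewrite sqr_sqrtr// addr_ge0// ipv_ge0. Qed.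

Lemma ip_expand (s t : R) f g : L2 f -> L2 g ->
  ip (fun x => s * f x + t * g x) (fun x => s * f x + t * g x) =
  s ^+ 2 * ip f f + 2 * s * t * ip f g + t ^+ 2 * ip g g.
Proof.
move=> fL gL; rewrite /ip.
have ff := L2M fL fL; have fg := L2M fL gL; have gg := L2M gL gL.
rewrite -!integZ// -!integD//; try by do ?apply: L1D; exact: L1Z.
by congr integ; apply/funext => x; ring.
Qed.

Lemma ipv_expand (s t : R) u v : L2v u -> L2v v ->
  0 <= s ^+ 2 * ipv u u + 2 * s * t * ipv u v + t ^+ 2 * ipv v v.
Proof.
move=> [u1 u2] [v1 v2].
have := ip_ge0 (fun x => s * u.1 x + t * v.1 x).
have := ip_ge0 (fun x => s * u.2 x + t * v.2 x).
by rewrite !ip_expand// /ipv; lra.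
Qed.

(** A binary quadratic form that is nonnegative has nonnegative discriminant.  The
    form with both coefficients as variables avoids division by the norms. *)
Lemma discriminant (a b c : R) : 0 <= a -> 0 <= c ->
  (forall s t : R, 0 <= s ^+ 2 * a ^+ 2 + 2 * s * t * b + t ^+ 2 * c ^+ 2) ->
  b <= a * c.
Proof.
move=> a0 c0 q; rewrite leNgt; apply/negP => acb.
have b0 : 0 < b by apply: le_lt_trans acb; rewrite mulr_ge0.
have q3 := q c (- a).
have bV : b^-1 * b = 1 by rewrite mulVf ?gt_eqF.
have [a_eq|an0] := eqVneq a 0.
  move: (q ((c ^+ 2 + 1) / b) (-1)); rewrite a_eq.
  rewrite (_ : 2 * ((c ^+ 2 + 1) / b) * -1 * b = - 2 * (c ^+ 2 + 1) * (b^-1 * b)); last by ring.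
  by rewrite bV; have := sqr_ge0 c; lra.
have [c_eq|cn0] := eqVneq c 0.
  move: (q (-1) ((a ^+ 2 + 1) / b)); rewrite c_eq.
  rewrite (_ : 2 * -1 * ((a ^+ 2 + 1) / b) * b = - 2 * (a ^+ 2 + 1) * (b^-1 * b)); last by ring.
  by rewrite bV; have := sqr_ge0 a; lra.
have ac0 : 0 < a * c by rewrite mulr_gt0// lt_def ?an0 ?cn0.
have : 0 <= (a * c) * (a * c - b) by move: q3; nra.
by rewrite pmulr_rge0// subr_ge0 leNgt acb.
Qed.

Lemma cauchy_schwarz u v : L2v u -> L2v v -> ipv u v <= normL2v u * normL2v v.
Proof.
move=> uL vL; apply: discriminant; [exact: sqrtr_ge0|exact: sqrtr_ge0|].
by move=> s t; rewrite !normL2v_sqr; exact: ipv_expand.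
Qed.

(** Nonnegativity of [|w' - w|^2], the numerical dissipation of backward Euler. *)
Lemma ip_diff w w' : L2 w -> L2 w' ->
  ip w' w' - ip w w <= 2 * ip (w' - w) w'.
Proof.
move=> wL wL'; have := ip_ge0 (fun x => 1 * w' x + (-1) * w x).
rewrite ip_expand//.
have -> : ip (w' - w) w' = ip w' w' - ip w w'.
  rewrite /ip -integB; [|exact: L2M..].
  by congr integ; apply/funext => x; rewrite -mulrBl.
by rewrite (ipC w w'); lra.
Qed.

Lemma ipv_diff u u' : L2v u -> L2v u' ->
  ipv u' u' - ipv u u <= 2 * ipv (u' - u) u'.
Proof.
move=> [u1 u2] [u1' u2']; have := ip_diff u1 u1'; have := ip_diff u2 u2'.
by rewrite /ipv/=; lra.
Qed.

Lemma ipvDl u v F : L2v u -> L2v v -> L2v F -> ipv (u + v) F = ipv u F + ipv v F.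
Proof.
move=> [u1 u2] [v1 v2] [F1 F2]; rewrite /ipv/=.
have D f g h : L2 f -> L2 g -> L2 h -> ip (f + g) h = ip f h + ip g h.
  move=> fL gL hL; rewrite /ip -integD; [|exact: L2M..].
  by congr integ; apply/funext => x; rewrite -mulrDl.
by rewrite !D//; ring.
Qed.

Lemma normL2v_triangle u v : L2v u -> L2v v ->
  normL2v u <= normL2v v + normL2v (v - u).
Proof.
move=> uL vL; have dL : L2v (v - u) by exact: L2vB.
rewrite -(@ler_pXn2r _ 2) ?nnegrE ?addr_ge0 ?sqrtr_ge0//.
have nN : normL2v (u - v) = normL2v (v - u).
  rewrite /normL2v /ipv /ip; congr (Num.sqrt (_ + _)); congr integ;
  by apply/funext => x /=; rewrite !fctE; ring.
have dL' : L2v (u - v) by exact: L2vB.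
have := cauchy_schwarz vL dL'; rewrite nN.
have e : ipv u u = ipv v v + 2 * ipv v (u - v) + ipv (u - v) (u - v).
  have C (a b : vfield R) : ipv a b = ipv b a by rewrite /ipv !(ipC b.1) !(ipC b.2).
  have G d : L2v d -> L2v (d + v) ->
      ipv (d + v) (d + v) = ipv v v + 2 * ipv v d + ipv d d.
    move=> dL'' dvL; rewrite ipvDl// (C d) (C v) !ipvDl// (C d v); ring.
  by have := G _ dL'; rewrite subrK => /(_ uL).
by rewrite sqrrD -nN !normL2v_sqr e -[_ *+ 2]mulr_natl; lra.
Qed.

End inner_product.

(** * The forms of the scheme on H^1 *)

Section sobolev.
Context {R : realType}.
Implicit Types (f g h w q : sfield R) (u v F : vfield R).

Lemma H1z_grad f : H1z f -> is_wgrad f (grad f).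
Proof. by move=> [_ exg]; exact: getPex exg. Qed.

Lemma H1z_L2 f : H1z f -> L2 f.
Proof. by move=> [[/L2perL2]]. Qed.

Lemma H1zv_L2v v : H1zv v -> L2v v.
Proof. by move=> [? ?]; split; exact: H1z_L2. Qed.

Lemma grad_L2v f : H1z f -> L2v (grad f).
Proof. by move=> /H1z_grad[g1 g2 _]; split; exact: L2perL2. Qed.

Lemma grad_wderiv f : H1z f ->
  wderiv true f (grad f).1 /\ wderiv false f (grad f).2.
Proof.
move=> /H1z_grad[_ _ gf]; split=> phi tphi;
by have [] := gf phi (trig_smooth tphi) (trig_periodic tphi).
Qed.

(** Test with the constant 1. *)
Lemma integ_wderiv i f g : wderiv i f g -> integ g = 0.
Proof.
move=> /(_ _ (trig_cst 1)); rewrite pd_cst /ip => e.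
apply: oppr_inj; rewrite oppr0.
rewrite [in LHS](_ : g = fun x => g x * 1); last by apply/funext => x; rewrite mulr1.
by rewrite -e; under eq_fun do rewrite mulr0; exact: integ0.
Qed.

(** Makes the curl of the initial velocity an admissible argument of the scalar
    interpolation operator. *)
Lemma curl_L2z v : H1zv v -> L2z (curl v).
Proof.
move=> [v1 v2]; have [w2 _] := grad_wderiv v2; have [_ w1] := grad_wderiv v1.
have [/L2perL2 L2a _ _] := H1z_grad v2; have [_ /L2perL2 L2b _] := H1z_grad v1.
have [[_ _ pa] _ _] := H1z_grad v2; have [_ [_ _ pb] _] := H1z_grad v1.
have [mc lc] := L2B L2a L2b.
split; first split => //.
- by move=> x; have [a1 a2] := pa x; have [b1 b2] := pb x; rewrite /curl/= a1 a2 b1 b2.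
- rewrite /curl integB; [|exact: L2_L1..].
  by rewrite (integ_wderiv w2) (integ_wderiv w1) subrr.
Qed.

Lemma H1z_cont_periodic f : H1z f -> continuous f -> cont_periodic f.
Proof.
by move=> [[[mf _ pf] _] _] cf; split => //; exact: continuous_bounded_meas.
Qed.

(** The two directions of [wderiv_transport] add up to the skew-symmetric form. *)
Lemma bstar_skew u w : H1zv u -> continuous u.1 -> continuous u.2 ->
  H1z w -> continuous w -> bstar u w w = 0.
Proof.
move=> [H1 H2] c1 c2 Hw cw.
have n1 := H1z_cont_periodic H1 c1; have n2 := H1z_cont_periodic H2 c2.
have nw := H1z_cont_periodic Hw cw.
have [/L2_L1 g11 _] := grad_L2v H1; have [_ /L2_L1 g22] := grad_L2v H2.
have [/L2_L1 gw1 /L2_L1 gw2] := grad_L2v Hw.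
have [d1 _] := grad_wderiv H1; have [_ d2] := grad_wderiv H2.
have [dw1 dw2] := grad_wderiv Hw.
have t1 := wderiv_transport n1 nw g11 gw1 d1 dw1.
have t2 := wderiv_transport n2 nw g22 gw2 d2 dw2.
have [b1 _ _] := n1; have [b2 _ _] := n2; have [bw _ _] := nw.
rewrite /bstar.
have -> : ip (fun x => u.1 x * (grad w).1 x + u.2 x * (grad w).2 x) w =
  ip (fun x => u.1 x * (grad w).1 x) w + ip (fun x => u.2 x * (grad w).2 x) w.
  rewrite /ip -integD; [|by apply: L1Mr => //; exact: L1M..].
  by congr integ; apply/funext => x; rewrite mulrDl.
have -> : ip (fun x => div u x * w x) w =
  ip (fun x => (grad u.1).1 x * w x) w + ip (fun x => (grad u.2).2 x * w x) w.
  rewrite /ip -integD; [|by apply: L1Mr => //; exact: L1Mr..].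
  by congr integ; apply/funext => x; rewrite /div; ring.
lra.
Qed.

Lemma ipv_cross w u : H1zv u -> continuous u.1 -> continuous u.2 -> L2 w ->
  ipv (cross w u) u = 0.
Proof.
move=> [H1 H2] c1 c2 wL.
have [b1 _ _] := H1z_cont_periodic H1 c1; have [b2 _ _] := H1z_cont_periodic H2 c2.
rewrite /ipv /ip /cross /= -integD.
- rewrite -[RHS](@integ0 R); congr integ; apply/funext => x; ring.
- apply: L1Mr => //; have := L1N (L1M b2 (L2_L1 wL)).
  by under eq_fun do rewrite -mulNr.
- by apply: L1Mr => //; apply: L1M => //; exact: L2_L1.
Qed.

(** Rotating the gradient by a right angle keeps its norm. *)
Lemma ipcurl_le F w : L2v F -> H1z w -> ipcurl F w <= normL2v F * normgrad w.
Proof.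
move=> [F1 F2] Hw; have [g1 g2] := grad_L2v Hw.
have L' : L2v ((grad w).2, fun x => - (grad w).1 x) by split => //; exact: L2N.
have -> : ipcurl F w = ipv F ((grad w).2, fun x => - (grad w).1 x).
  rewrite /ipcurl /ipv /ip -integD; last exact: L2M F2 L'.2.
    by congr integ; apply/funext => x; rewrite /= mulrN.
  exact: L2M F1 g2.
have -> : normgrad w = normL2v ((grad w).2, fun x => - (grad w).1 x).
  rewrite /normgrad /normL2v /ipv /= addrC; congr (Num.sqrt (_ + _)).
  by rewrite /ip; congr integ; apply/funext => x; ring.
exact: cauchy_schwarz.
Qed.

End sobolev.

(** * Forcing at a time step and essential suprema in time *)

Section forcing.
Context {R : realType}.
Implicit Types (v F : vfield R).

(** If [N (f t)] exceeded an essential bound [y] of [N] along [f], then by the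
    Lipschitz condition [N (f s)] would exceed [y] for all [s] in the set of times
    that [essential_value] declares to be non-negligible. *)
Lemma essential_value_le (N : vfield R -> R) (c : R) (f : R -> vfield R) (t : R) :
  0 < c ->
  (forall s, 0 < s -> N (f t) <= N (f s) + c * normL2v (f s - f t)) ->
  essential_value f t ->
  ((N (f t))%:E <= norm_Linfty (fun s => N (f s)))%E.
Proof.
move=> c0 Nc ef; apply: le_ereal_inf_tmp => y /= aey.
rewrite leNgt; apply/negP => yN.
have [r yr rN] : exists2 r : R, (y <= r%:E)%E & r < N (f t).
  case: y yN {aey} => [r| |] yN.
  - by exists r => //; rewrite -lte_fin.
  - by move: yN; rewrite ltNge leey.
  - by exists (N (f t) - 1); [rewrite leNye|rewrite ltrBlDr ltrDl].
have e0 : 0 < (N (f t) - r) / c by rewrite divr_gt0// subr_gt0.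
apply: (ef _ e0); case: aey => A [mA A0 sA].
exists (A `&` halfline); split.
- by apply: measurableI => //; exact: measurable_halfline.
- exact: A0.
- move=> s [s0 _ ns]; split; last by rewrite /halfline /= in_itv/= s0.
  apply: sA => /= sy; have := le_trans sy yr; rewrite lee_fin => Nr.
  have := Nc s s0; move: ns; rewrite ltr_pdivlMr// mulrC; lra.
Qed.

Variables (lambda : R) (Xh : set (vfield R)) (Qh : set (sfield R)).
Hypotheses (lambda_poincare : poincare_constant lambda) (XhH1 : Xh `<=` H1zv).

Lemma ipv_normgradv_le v F : H1zv v -> L2v F ->
  ipv F v <= normL2v F * lambda * normgradv v.
Proof.
move=> Hv FL; apply: le_trans (cauchy_schwarz FL (H1zv_L2v Hv)) _.
rewrite -mulrA; apply: ler_wpM2l; first exact: sqrtr_ge0.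
by have [_ + _] := lambda_poincare; apply.
Qed.

Lemma dual_ratio_le v F : H1zv v -> L2v F ->
  ipv F v / normgradv v <= normL2v F * lambda.
Proof.
move=> Hv FL; have [l0 _ _] := lambda_poincare.
have : 0 <= normgradv v by exact: sqrtr_ge0.
rewrite le_eqVlt => /predU1P[<-|g0].
  by rewrite invr0 mulr0 mulr_ge0 ?sqrtr_ge0// ltW.
by rewrite ler_pdivrMr//; exact: ipv_normgradv_le.
Qed.

Lemma dual_ratio_le_dual_norm v F : L2v F -> Vh Xh Qh v -> v <> 0 ->
  ipv F v / normgradv v <= dual_norm Xh Qh F.
Proof.
move=> FL Vv v0; apply: ub_le_sup; last by exists v.
exists (normL2v F * lambda) => _ [z [[/XhH1 Hz _] _] <-]; exact: dual_ratio_le.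
Qed.

Lemma ipv_dual_norm_le v F : L2v F -> Vh Xh Qh v -> v <> 0 ->
  ipv F v <= dual_norm Xh Qh F * normgradv v.
Proof.
move=> FL Vv v0; have : 0 <= normgradv v by exact: sqrtr_ge0.
have Hv := XhH1 Vv.1.
rewrite le_eqVlt => /predU1P[g0|g0].
  by rewrite -g0 mulr0; have := ipv_normgradv_le Hv FL; rewrite -g0 mulr0.
by rewrite -ler_pdivrMr//; exact: dual_ratio_le_dual_norm.
Qed.

(** Poincare's inequality makes each quotient in the supremum Lipschitz with
    constant [lambda].  When there is no nonzero test field both suprema are 0. *)
Lemma dual_norm_lipschitz F F' : L2v F -> L2v F' ->
  dual_norm Xh Qh F <= dual_norm Xh Qh F' + lambda * normL2v (F' - F).
Proof.
move=> FL FL'; have [l0 _ _] := lambda_poincare.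
pose S := [set v | Vh Xh Qh v /\ v <> 0].
have [[v Sv]|/forallNP S0] := pselect (exists v, S v); last first.
  have dn0 G : dual_norm Xh Qh G = 0.
    rewrite /dual_norm (_ : [set v | _] = set0) ?image_set0 ?sup0//.
    by rewrite -subset0 => v /S0.
  by rewrite !dn0 add0r mulr_ge0 ?sqrtr_ge0// ltW.
apply: ge_sup; first by exists (ipv F v / normgradv v), v.
move=> _ [z [Vz z0] <-].
have dL : L2v (F - F') by exact: L2vB.
have Hz := XhH1 Vz.1.
have -> : ipv F z = ipv F' z + ipv (F - F') z.
  by rewrite -ipvDl ?subrKC//; exact: H1zv_L2v.
rewrite mulrDl lerD//; first exact: dual_ratio_le_dual_norm.
rewrite mulrC; apply: le_trans (_ : _ <= normL2v (F - F') * lambda) _.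
  by rewrite mulrC; exact: dual_ratio_le.
rewrite mulrC /normL2v /ipv /ip ler_wpM2l ?(ltW l0)// ler_wsqrtr// le_eqVlt.
apply/orP; left; apply/eqP; congr (_ + _); congr integ; apply/funext => x /=;
by rewrite !fctE; ring.
Qed.

End forcing.

(** * The energy recursion *)

Section energy.
Context {R : realType}.

(** [d] is the tested time difference, [F] the tested forcing and [m] a bound of
    the forcing.  Of the [2 nu dt G^2] of dissipation, [nu dt G^2 / 2] pays for
    Young's inequality, [nu dt G^2] for Poincare's. *)
Lemma energy_step (nu dt lambda E E' G d F m : R) :
  0 < nu -> 0 < dt -> 0 < lambda -> 0 <= G ->
  dt^-1 * d + nu * G ^+ 2 = F -> E' - E <= 2 * d -> E' <= lambda ^+ 2 * G ^+ 2 ->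
  F <= m * G ->
  (1 + nu * lambda ^- 2 * dt) * E' + nu * dt / 2 * G ^+ 2 <= E + 2 * dt / nu * m ^+ 2.
Proof.
move=> nu0 dt0 l0 G0 eF dE pE Fm.
have dE' : d = dt * (F - nu * G ^+ 2) by rewrite -eF addrK mulrA mulfV ?mul1r// gt_eqF.
have young : 2 * dt * (m * G) <= nu * dt / 2 * G ^+ 2 + 2 * dt / nu * m ^+ 2.
  rewrite -subr_ge0 (_ : _ - _ = 2 * dt / nu * (nu / 2 * G - m) ^+ 2).
    by rewrite mulr_ge0 ?sqr_ge0// divr_ge0 ?mulr_ge0// ltW.
  by field; rewrite gt_eqF.
have dtF : dt * F <= dt * (m * G) by rewrite ler_pM2l.
have pE' : nu * dt * (lambda ^- 2 * E') <= nu * dt * G ^+ 2.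
  rewrite ler_pM2l ?mulr_gt0// mulrC ler_pdivrMr ?exprn_gt0// mulrC//.
rewrite dE' in dE; lra.
Qed.

(** [L] dominates the fixed point [B / (alpha - 1)] of the recursion, so that it
    can be carried along unchanged. *)
Lemma discrete_gronwall (alpha c B L : R) (E G : nat -> R) :
  0 < alpha -> 0 <= L -> B <= (alpha - 1) * L ->
  (forall k, alpha * E k.+1 + c * G k.+1 <= E k + B) ->
  forall n, E n + c * \sum_(0 <= k < n) alpha^-1 ^+ (n - k) * G k.+1
    <= alpha^-1 ^+ n * E 0%N + L.
Proof.
move=> a0 L0 BL step; elim=> [|n IHn].
  by rewrite big_nil mulr0 addr0 mul1r lerDl.
have an0 : alpha != 0 by rewrite gt_eqF.
rewrite big_nat_recr//= subSnn expr1.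
under eq_big_nat => k /andP[_ kn] do rewrite subSn 1?ltnW// exprS -mulrA.
rewrite -mulr_sumr exprS -(ler_pM2l a0).
set S := \sum_(0 <= k < n) _ in IHn *; set T := alpha^-1 ^+ n * E 0%N in IHn *.
have -> : alpha * (E n.+1 + c * (alpha^-1 * S + alpha^-1 * G n.+1)) =
    alpha * E n.+1 + c * G n.+1 + c * S by field.
have -> : alpha * (alpha^-1 * alpha^-1 ^+ n * E 0%N + L) = T + alpha * L.
  by rewrite /T; field.
by have := step n; move: IHn BL; rewrite mulrBl mul1r; lra.
Qed.

End energy.

(** * The stability estimates *)

Lemma ipv0 (R : realType) (F : vfield R) : ipv F 0 = 0.
Proof.
rewrite /ipv /ip -[RHS](addr0 0) -(@integ0 R).
by congr (_ + _); congr integ; apply/funext => x; rewrite mulr0.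
Qed.

(** Reduction to a finite essential bound: for an infinite one the right-hand
    side is [+oo], the square of [-oo] being [+oo] as well. *)
Lemma ereal_estimate (R : realType) (X Y c : R) (M : \bar R) :
  0 < c -> (forall m : R, M = m%:E -> X <= Y + c * m ^+ 2) ->
  (X%:E <= Y%:E + c%:E * M ^+ 2)%E.
Proof.
move=> c0; case: M => [m| |] H.
- by rewrite -EFin_expe -EFinM -EFinD lee_fin; exact: H.
- by rewrite expe2 mulyy gt0_muley ?lte_fin// addey// leey.
- by rewrite expe2 mulNyNy gt0_muley ?lte_fin// addey// leey.
Qed.

Theorem theorem3p1 (R : realType)
    (tau : seq (3.-tuple (R * R)))
    (Xh : set (vfield R)) (Qh Yh : set (sfield R))
    (IX : vfield R -> vfield R) (IY : sfield R -> sfield R)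
    (lambda nu dt : R) (f : R -> vfield R) (u0 : vfield R)
    (u : nat -> vfield R) (p w : nat -> sfield R) :
  triangulation tau ->
  fe_spaces tau Xh Qh Yh ->
  (forall v, H1zv v -> Xh (IX v)) ->
  (forall q, L2z q -> Yh (IY q)) ->
  poincare_constant lambda ->
  Linfty_L2 f ->
  H1zv u0 ->
  0 < nu ->
  0 < dt ->
  (forall n : nat, essential_value f (n.+1%:R * dt)) ->
  be_vv_solution Xh Qh Yh IX IY nu dt f u0 u p w ->
  let alpha := 1 + nu * lambda ^- 2 * dt in
  forall n : nat, (0 < n)%N ->
    ((normL2v (u n) ^+ 2 + nu * dt / 2 *
        \sum_(0 <= k < n) alpha^-1 ^+ (n - k) * normgradv (u k.+1) ^+ 2)%:E
     <= (alpha^-1 ^+ n * normL2v (u 0%N) ^+ 2)%:E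
        + (2 * alpha * lambda ^+ 2 / nu ^+ 2)%:E
          * norm_Linfty (fun t => dual_norm Xh Qh (f t)) ^+ 2)%E
    /\
    ((normL2 (w n) ^+ 2 + nu * dt / 2 *
        \sum_(0 <= k < n) alpha^-1 ^+ (n - k) * normgrad (w k.+1) ^+ 2)%:E
     <= (alpha^-1 ^+ n * normL2 (w 0%N) ^+ 2)%:E
        + (2 * alpha * lambda ^+ 2 / nu ^+ 2)%:E
          * norm_Linfty (fun t => normL2v (f t)) ^+ 2)%E.
Proof.
move=> _ fe IXh IYh lamP [fL2 _ _] Hu0 nu0 dt0 fess sol alpha.
have [l0 pX pY] := lamP.
have [XH _ YH] := fe_conforming fe.
have lneq0 : lambda != 0 by rewrite gt_eqF.
have nneq0 : nu != 0 by rewrite gt_eqF.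
have alpha0 : 0 < alpha.
  by rewrite ltr_wpDr// !mulr_ge0 ?invr_ge0 ?exprn_ge0// ltW.
have C0 : 0 < 2 * alpha * lambda ^+ 2 / nu ^+ 2.
  by rewrite !mulr_gt0// ?invr_gt0 exprn_gt0.
have u_mem n : Xh (u n).
  case: n => [|n]; last by have [] := be_mem sol n.
  by rewrite (be_init_u sol); exact: IXh.
have w_mem n : Yh (w n).
  case: n => [|n]; last by have [] := be_mem sol n.
  by rewrite (be_init_w sol); apply/IYh/curl_L2z.
have t_gt0 n : 0 < n.+1%:R * dt by rewrite mulr_gt0.
have fL n : L2v (f (n.+1%:R * dt)) by exact/L2zv_L2v/fL2.
(* a step contributes [2 dt / nu * m^2], and [alpha - 1 = nu dt / lambda^2] *)
have forcing_bound (m : R) : 2 * dt / nu * m ^+ 2 <=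
    (alpha - 1) * (2 * alpha * lambda ^+ 2 / nu ^+ 2 * m ^+ 2).
  have -> : (alpha - 1) * (2 * alpha * lambda ^+ 2 / nu ^+ 2 * m ^+ 2) =
      alpha * (2 * dt / nu * m ^+ 2).
    by rewrite /alpha; field; rewrite nneq0 lneq0.
  apply: ler_peMl.
    by rewrite mulr_ge0 ?sqr_ge0// divr_ge0 ?mulr_ge0// ltW.
  by rewrite /alpha lerDl !mulr_ge0 ?invr_ge0 ?exprn_ge0// ltW.
have CL0 (m : R) : 0 <= 2 * alpha * lambda ^+ 2 / nu ^+ 2 * m ^+ 2.
  by rewrite mulr_ge0 ?sqr_ge0// ltW.
move=> n _; split; apply: ereal_estimate => // m Mm.
- apply: (discrete_gronwall (E := fun k => normL2v (u k) ^+ 2)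
    (G := fun k => normgradv (u k) ^+ 2) alpha0 (CL0 m) (forcing_bound m)) => k.
  have Hu := XH _ (u_mem k.+1); have Hu' := XH _ (u_mem k).
  have [c1 c2] := fe_continuousX fe (u_mem k.+1).
  have [_ pm _] := be_mem sol k.
  have := be_momentum sol k (u_mem k.+1).
  rewrite (ipv_cross Hu c1 c2 (H1z_L2 (YH _ (w_mem k)))) (ipC (p k.+1)).
  rewrite (be_continuity sol k pm) addr0 subr0 -normgradv_sqr => eF.
  rewrite -(real_normK (num_real m)).
  apply: (energy_step nu0 dt0 l0 _ eF); first exact: sqrtr_ge0.
  + by rewrite !normL2v_sqr; apply: ipv_diff; exact: H1zv_L2v.
  + by rewrite -exprMn ler_pXn2r ?nnegrE ?mulr_ge0 ?sqrtr_ge0 ?(ltW l0)//; exact: pX.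
  + have g0 : 0 <= normgradv (u k.+1) by exact: sqrtr_ge0.
    (* the dual norm only controls fields different from zero *)
    have [un0|un0] := pselect (u k.+1 = 0).
      by rewrite [X in ipv _ X]un0 ipv0 mulr_ge0.
    have Vu : Vh Xh Qh (u k.+1).
      by split => // q Qq; exact: (be_continuity sol k Qq).
    apply: le_trans (ipv_dual_norm_le lamP XH (fL k) Vu un0) _.
    apply: ler_wpM2r => //; apply: le_trans (ler_norm m).
    rewrite -lee_fin -Mm.
    apply: (@essential_value_le _ (dual_norm Xh Qh) lambda) => // s s0.
    by apply: (dual_norm_lipschitz Qh lamP XH) => //; exact/L2zv_L2v/fL2.
- apply: (discrete_gronwall (E := fun k => normL2 (w k) ^+ 2)
    (G := fun k => normgrad (w k) ^+ 2) alpha0 (CL0 m) (forcing_bound m)) => k.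
  have Hw := YH _ (w_mem k.+1); have Hw' := YH _ (w_mem k).
  have [c1 c2] := fe_continuousX fe (u_mem k.+1).
  have := be_vorticity sol k (w_mem k.+1).
  rewrite (bstar_skew (XH _ (u_mem k.+1)) c1 c2 Hw (fe_continuousY fe (w_mem k.+1))).
  rewrite addr0 -normL2v_sqr -/(normgrad _) => eF.
  apply: (energy_step nu0 dt0 l0 _ eF); first exact: sqrtr_ge0.
  + by rewrite !normL2_sqr; apply: ip_diff; exact: H1z_L2.
  + by rewrite -exprMn ler_pXn2r ?nnegrE ?mulr_ge0 ?sqrtr_ge0 ?(ltW l0)//; exact: pY.
  + apply: le_trans (ipcurl_le (fL k) Hw) _.
    apply: ler_wpM2r; first exact: sqrtr_ge0.
    rewrite -lee_fin -Mm.
    apply: (@essential_value_le _ (@normL2v R) 1) => // s s0; rewrite mul1r.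
    by apply: normL2v_triangle => //; exact/L2zv_L2v/fL2.
Qed.
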